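(* Let $q_0$ be a prime power, $q=q_0^2$, let $m>2$ be a divisor of $q_0+1$, and suppose that $\Delta=\frac{q_0+1}{m}>3$ is a prime. Let $\mathcal X_m$ be the non-singular model of the plane curve over $\mathbb F_q$ with affine equation $$X^{2m}+X^m+Y^{q_0+1}=0,$$ and let $\bar x,\bar y$ be the corresponding coordinate functions. Let $\omega$ be a primitive $m$-th root of $-1$ (so $\omega^m=-1$), and let $P$ be an $\mathbb F_q$-rational point of $\mathcal X_m$ such that - $\left(\frac{1}{\bar x-\omega}\right)_\infty=(q_0+1)P$; - $\left(\frac{\bar x^{-1}\bar y^{\Delta}}{\bar x-\omega}\right)_\infty=(q_0+1-\Delta)P$; - $\left(\frac{\bar y^{n}}{\bar x-\omega}\right)_\infty=(q_0+1-n)P$ for all $n=1,\ldots,\frac{\Delta-1}{2}$. Then the Weierstrass semigroup of $\mathcal X_m$ at $P$ is $$H(P)=\left\langle q_0+1-\Delta,\ q_0+1-\tfrac{\Delta-1}{2},\ q_0+1-\tfrac{\Delta-1}{2}+1,\ \ldots,\ q_0+1\right\rangle .$$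
   Context: Curves are projective, geometrically irreducible, non-singular algebraic curves over a finite field. For a rational function $f$, $(f)_\infty$ is its pole divisor. For an $\mathbb F_q$-rational point $P$, $H(P)$ is the Weierstrass semigroup of non-gaps at $P$: the set of integers $n\ge 0$ such that there is a rational function with pole divisor $nP$. $\langle a_1,\dots,a_r\rangle$ denotes the numerical semigroup (containing $0$) generated by $a_1,\dots,a_r$. It is known (Giulietti–Hirschfeld–Korchmáros–Torres) that $\mathcal X_m$ has genus $\frac12 m(q_0-2)+1$ and that a point $P$ with the listed properties exists. *)

(* Defs.v *)
From HB Require Import structures.
From mathcomp Require Import all_boot all_order all_algebra.
From mathcomp Require Import boolp classical_sets.
Set Implicit Arguments.
Unset Strict Implicit.
Unset Printing Implicit Defensive.
Import Order.TTheory GRing.Theory Num.Theory.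
Local Open Scope ring_scope.

(* MathComp has no structure for fields that are infinite-dimensional algebras
   over F, so an extension L of F is given by its embedding emb. *)

(* In a bivariate polynomial g : {poly {poly F}}, the outer indeterminate 'X
   stands for the first coordinate and 'Y = 'X%:P for the second. *)
Definition eval2 (F L : fieldType) (emb : {rmorphism F -> L})
    (g : {poly {poly F}}) (x y : L) : L :=
  (map_poly (map_poly emb) g).[x, y].

(* L is the field of fractions of F[X,Y]/(f), with x and y the classes of X
   and Y: the rational function field of the plane curve f = 0, and hence of
   its non-singular model. *)
Definition is_function_field_of_plane_curve (F L : fieldType)
    (emb : {rmorphism F -> L}) (f : {poly {poly F}}) (x y : L) : Prop :=
  (forall g : {poly {poly F}},
      eval2 emb g x y = 0 <-> exists h : {poly {poly F}}, g = h * f) /\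
  (forall z : L, exists g h : {poly {poly F}},
      eval2 emb h x y != 0 /\ z = eval2 emb g x y / eval2 emb h x y).

(* The closed points of the non-singular projective curve over F with function
   field L are the normalized discrete valuations of L that are trivial on F.
   The order of 0 would be +oo; it is set to the dummy value 0, so that equal
   valuations are equal as functions. *)
Record place (F L : fieldType) (emb : {rmorphism F -> L}) := Place {
  ord_at :> L -> int;
  ord_at0 : ord_at 0 = 0;
  ord_atM : forall f g : L, f != 0 -> g != 0 ->
    ord_at (f * g) = ord_at f + ord_at g;
  ord_atD : forall f g : L, f != 0 -> g != 0 -> f + g != 0 ->
    Num.min (ord_at f) (ord_at g) <= ord_at (f + g);
  ord_at_const : forall c : F, ord_at (emb c) = 0;
  ord_at_uniformizer : exists2 t : L, t != 0 & ord_at t = 1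
}.

(* The residue field at P is F, i.e. P has degree one. *)
Definition rational_place (F L : fieldType) (emb : {rmorphism F -> L})
    (P : place emb) : Prop :=
  forall f : L, 0 <= P f ->
    exists c : F, f = emb c \/ 0 < P (f - emb c).

(* Divisors are given by their coefficient functions. *)
Definition divisor (F L : fieldType) (emb : {rmorphism F -> L}) : Type :=
  place emb -> int.

Definition pole_divisor (F L : fieldType) (emb : {rmorphism F -> L})
    (f : L) : divisor emb :=
  fun Q => Num.max 0 (- Q f).
Arguments pole_divisor {F L} emb f.

Definition point_divisor (F L : fieldType) (emb : {rmorphism F -> L})
    (n : nat) (P : place emb) : divisor emb :=
  fun Q => if `[< Q = P >] then n%:Z else 0.

Definition weierstrass_semigroup (F L : fieldType) (emb : {rmorphism F -> L})
    (P : place emb) : set nat :=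
  [set n | exists2 f : L, f != 0 &
     pole_divisor emb f = point_divisor n P]%classic.

Definition generated_semigroup (s : seq nat) : set nat :=
  [set n | exists c : 'I_(size s) -> nat,
     n = (\sum_(i < size s) c i * nth 0 s i)%N]%classic.

(* For a = -1; in characteristic 2 these are the primitive m-th roots of 1. *)
Definition primitive_root_of (F : fieldType) (m : nat) (a w : F) : Prop :=
  w ^+ m = a /\ forall i : nat, (0 < i < m)%N -> w ^+ i <> a.

Definition Xm_poly (F : fieldType) (q0 m : nat) : {poly {poly F}} :=
  'X^(2 * m) + 'X^m + 'Y ^+ (q0 + 1).

(* Main.v *)
Require Import Defs.
From HB Require Import structures.
From mathcomp Require Import all_boot all_order all_algebra.
From mathcomp Require Import boolp classical_sets.
From mathcomp Require Import ring zify cyclic finfield.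
Set Implicit Arguments.
Unset Strict Implicit.
Unset Printing Implicit Defensive.
Import Order.TTheory GRing.Theory Num.Theory.
Local Open Scope ring_scope.

(** Put N = q0 + 1 = m Delta and u = 1 / (x - omega).  The hypotheses say that
    u has a pole of order N at P and no other pole, and that y has order 1 at
    P.  No genus is computed; the pole numbers are read off the action of a
    cyclic group.

    The curve is the cyclic cover y^N = - x^m (x^m + 1) of the x-line.  As N
    divides q - 1, F contains a primitive N-th root of unity eta, and
    y |-> eta y extends to an automorphism s of L over F (x) = F (u)
    (curve_automorphism), whose fixed field is F (u) (fixed_in_Fu).  It fixes
    u, hence P, so it acts on the ring R of the functions that are regular
    outside P.  A function f of R is therefore the sum of its components
    f_i = g_i y^i, 0 <= i < N, with g_i in F (u), and each f_i is again in R.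
    Since u has order - N at P, the order of f_i is i modulo N; these orders
    are distinct, and the order of f is that of one of the f_i.

    For this i, f_i^N is in F (u) and regular outside P, so it is a polynomial
    p (u) (regular_in_Fu_polynomial).  Write g_i = a (u) / b (u) in lowest
    terms.  With W = 1 + omega u and B = W^m + u^m one has
    y^N u^(2m) = - W^m B, so that, up to sign,
      a^N (W^m B)^i = p b^N u^(2mi).
    B is squarefree and W, B, u are pairwise coprime; hence b^N divides
    W^(mi) and u^(2mi) divides a^N, i.e. Delta deg b <= i and
    2 i <= Delta deg a (fraction_bounds).  The pole number
    N (deg a - deg b) - i of f then lies in the semigroup by elementary
    arithmetic (pole_number_in_semigroup).  Conversely the given functions
    have the generators as pole numbers, and pole numbers add under products.

    The polynomiality of f_i^N requires that L has enough places: one has to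
    lie above a zero of any nonconstant b (u) (place_over_polynomial).  By
    Zorn's lemma, L has a maximal subring among those that contain F[u] but not
    1 / b (u); it is a valuation ring.  Every element of L is a root of a
    polynomial of degree N over F (u), so its values are commensurable with
    those of F (u), and the valuation is discrete. *)

(** * Valuation rings avoiding a given element *)

Section ValuationRings.
Variable L : fieldType.
Implicit Types (A : set L) (a b t : L) (p q : {poly L}).

Definition subring A : Prop :=
  [/\ A 1, (forall a b, A a -> A b -> A (a - b))
   & forall a b, A a -> A b -> A (a * b)].

Definition valuation_ring A : Prop :=
  subring A /\ forall a, A a \/ A a^-1.

Section Subring.
Variable A : set L.
Hypothesis sA : subring A.

Lemma subring1 : A 1. Proof. by case: sA. Qed.
Lemma subringB a b : A a -> A b -> A (a - b).
Proof. by case: sA => _ h _; apply: h. Qed.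
Lemma subringM a b : A a -> A b -> A (a * b).
Proof. by case: sA => _ _ h; apply: h. Qed.
Lemma subring0 : A 0.
Proof. by rewrite -(subrr 1); apply: subringB; apply: subring1. Qed.
Lemma subringN a : A a -> A (- a).
Proof. by move=> Aa; rewrite -sub0r; apply: subringB => //; apply: subring0. Qed.
Lemma subringD a b : A a -> A b -> A (a + b).
Proof.
by move=> Aa Ab; rewrite -(opprK b); apply: subringB => //; apply: subringN.
Qed.
Lemma subringX a n : A a -> A (a ^+ n).
Proof.
move=> Aa; elim: n => [|n IH]; first by rewrite expr0; apply: subring1.
by rewrite exprS; apply: subringM.
Qed.
Lemma subring_sum I (r : seq I) (Q : pred I) (f : I -> L) :
  (forall i, A (f i)) -> A (\sum_(i <- r | Q i) f i).
Proof.
by move=> Af; apply: big_ind => //; [apply: subring0 | apply: subringD].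
Qed.
End Subring.

Definition adjoin A t : set L :=
  [set z | exists2 p : {poly L}, (forall i, A p`_i) & z = p.[t]]%classic.

Lemma subring_adjoin A t : subring A -> subring (adjoin A t).
Proof.
move=> sA; split.
- exists 1; last by rewrite hornerE.
  move=> i; rewrite coef1; case: (_ == _); first exact: subring1.
  exact: subring0.
- move=> _ _ [p Ap ->] [q Aq ->]; exists (p - q); last by rewrite !hornerE.
  by move=> i; rewrite coefB; apply: subringB.
- move=> _ _ [p Ap ->] [q Aq ->]; exists (p * q); last by rewrite !hornerE.
  by move=> i; rewrite coefM; apply: subring_sum => // j; apply: subringM.
Qed.

Lemma sub_adjoin A t : subring A -> (A `<=` adjoin A t)%classic.
Proof.
move=> sA a Aa; exists a%:P; last by rewrite hornerC.
by move=> i; rewrite coefC; case: (_ == _) => //; apply: subring0.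
Qed.

Lemma mem_adjoin A t : subring A -> adjoin A t t.
Proof.
move=> sA; exists 'X; last by rewrite hornerX.
move=> i; rewrite coefX; case: (_ == _); first exact: subring1.
exact: subring0.
Qed.

Section MaximalExclusion.
Variables (A : set L) (c : L).
Hypotheses (sA : subring A) (Ac : A c) (AcV : ~ A c^-1).
Hypothesis maxA :
  forall B, subring B -> (A `<=` B)%classic -> ~ B c^-1 -> B = A.

Let c_neq0 : c != 0.
Proof. by apply/eqP => c0; apply: AcV; rewrite c0 invr0 -c0. Qed.

Lemma adjoin_excluded t : ~ A t -> adjoin A t c^-1.
Proof.
move=> At; apply: contrapT => ncV; apply: At.
rewrite -(maxA (subring_adjoin t sA) (@sub_adjoin A t sA) ncV).
exact: mem_adjoin.
Qed.

(** If the inverse of 1 - c b were not in A, then by maximality adjoining it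
    would produce 1 / c as a fraction a / (1 - c b) ^+ k with a in A.  As
    (1 - c b) ^+ k is 1 modulo c, this would make c invertible in A. *)
Lemma excluded_in_jacobson b : A b -> A (1 - c * b)^-1.
Proof.
move=> Ab; apply: contrapT => /adjoin_excluded [p Ap cVE].
set s := 1 - c * b in Ap cVE.
have As : A s by apply: subringB; [|apply: subring1|apply: subringM].
have s_neq0 : s != 0.
  rewrite subr_eq0; apply/eqP => cb1; apply: AcV.
  by rewrite (_ : c^-1 = b) // -[LHS]mulr1 cb1 mulKf.
have sX k : exists2 d, A d & s ^+ k = 1 - c * d.
  elim: k => [|k [d Ad sd]].
    by exists 0; [apply: subring0 | rewrite mulr0 subr0].
  exists (s * d + b); first by apply: subringD => //; apply: subringM.
  rewrite exprS sd mulrBr mulr1 mulrDr mulrCA opprD addrA addrAC.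
  by rewrite -/s /s.
have [d Ad sd] := sX (size p).
apply: AcV; suff -> : c^-1 = s ^+ size p * p.[s^-1] + d.
  apply: subringD => //.
  rewrite horner_coef mulr_sumr; apply: subring_sum => // i.
  rewrite mulrCA; apply: subringM => //.
  rewrite exprVn -expfB_cond; last by rewrite (negPf s_neq0) add0n ltnW.
  exact: subringX.
rewrite -cVE sd mulrBl mul1r mulrAC divff // mul1r.
by rewrite addrNK.
Qed.

Let reverse (m : nat) q := \poly_(k < m) q`_(m - k).

(** If neither t nor 1 / t is in A, both adjunctions produce 1 / c, whence
    relations c p(t) = 1 and c q(1/t) = 1.  The relation of smaller degree
    expresses a power of t through lower ones, since 1 - c q(0) is invertible
    in A; substituting lowers the degree of the other relation. *)
Lemma no_opposite_relations n t p q : (size p + size q <= n)%N ->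
  (forall i, A p`_i) -> (forall i, A q`_i) ->
  c * p.[t] = 1 -> c * q.[t^-1] = 1 -> False.
Proof.
elim: n t p q => [|n IHn] t p q szpq Ap Aq cp cq.
  move: szpq; rewrite leqn0 addn_eq0 !size_poly_eq0 => /andP[/eqP p0 _].
  by move/eqP: cp; rewrite p0 horner0 mulr0 eq_sym oner_eq0.
wlog szqp : t p q szpq Ap Aq cp cq / (size q <= size p)%N.
  move=> IH; case: (leqP (size q) (size p)) => [|/ltnW] szqp.
    exact: IH cp cq szqp.
  by apply: (IH t^-1 q p) => //; rewrite ?invrK // addnC.
have sz_gt1 (r : {poly L}) s :
    (forall i, A r`_i) -> c * r.[s] = 1 -> (1 < size r)%N.
  move=> Ar cr; rewrite ltnNge; apply/negP => /size1_polyC rE.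
  move: cr; rewrite rE hornerC => cr.
  by apply: AcV; rewrite (_ : c^-1 = r`_0) // -[LHS]mulr1 -cr mulKf.
have szq := sz_gt1 _ _ Aq cq.
have t_neq0 : t != 0.
  apply/eqP => t0; apply: AcV.
  by rewrite -[c^-1]mulr1 -cq t0 mulKf // invr0 horner_coef0.
case Em: (size q) szq => [|[|m']] // _; set m := m'.+1 in Em.
case El: (size p) szqp => [|l]; first by rewrite Em.
rewrite Em ltnS => le_ml.
pose s := 1 - c * q`_0.
have AsV : A s^-1 by apply: excluded_in_jacobson.
have s_neq0 : s != 0.
  rewrite subr_eq0; apply/eqP => cb1; apply: AcV.
  by rewrite (_ : c^-1 = q`_0) // -[LHS]mulr1 cb1 mulKf.
(* multiplying c q(1/t) = 1 by t^m gives s t^m = c r(t), with r of degree < m *)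
have tm : t ^+ m = c * (s^-1 *: reverse m q).[t].
  apply: (mulfI s_neq0); rewrite hornerZ mulrCA mulVKf //.
  rewrite /s mulrBl mul1r -{1}[t ^+ m]mulr1 -cq mulrCA -mulrA -mulrBr.
  congr (c * _); rewrite horner_coef Em big_ord_recl /= expr0 mulr1.
  rewrite [t ^+ m * _]mulrC mulrDl addrAC subrr add0r.
  rewrite mulr_suml (reindex_inj rev_ord_inj) horner_poly /=.
  apply: eq_bigr => i _; rewrite -mulrA; congr (_ * _).
    by rewrite /bump /= add1n subnSK // .
  rewrite /bump /= add1n subnSK // exprVn mulrC -expfB_cond ?subKn //.
  - by rewrite ltnW.
  - by rewrite (negPf t_neq0) add0n leq_subr.
pose p' := \poly_(i < l) p`_i
  + (p`_l * c) *: ('X ^+ (l - m) * (s^-1 *: reverse m q)).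
apply: (IHn t p' q) => //.
- have : (size p' <= l)%N.
    rewrite (leq_trans (size_polyD _ _)) // geq_max size_poly /=.
    rewrite (leq_trans (size_scale_leq _ _)) //.
    rewrite (leq_trans (size_polyMleq _ _)) // size_polyXn addSn /=.
    rewrite -[X in (_ <= X)%N](subnK le_ml) leq_add2l.
    by rewrite (leq_trans (size_scale_leq _ _)) // size_poly.
  move: szpq; rewrite El addSn ltnS => h1 h2.
  by apply: leq_trans h1; rewrite leq_add2r.
- move=> i; rewrite coefD coef_poly coefZ coefXnM coefZ coef_poly.
  apply: subringD => //; first by case: ifP => // _; apply: subring0.
  apply: subringM => //; first exact: subringM.
  case: ifP => _; first exact: subring0.
  by apply: subringM => //; case: ifP => _ //; apply: subring0.
- rewrite /p' hornerD hornerZ hornerM hornerXn -[p`_l * c * _]mulrA.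
  rewrite [c * (t ^+ (l - m) * _)]mulrCA.
  rewrite -tm -exprD subnK // -[RHS]cp; congr (c * _).
  by rewrite [p.[t]]horner_coef El big_ord_recr /= horner_poly.
Qed.

Lemma maximal_exclusion_valuation_ring : valuation_ring A.
Proof.
split=> // t; apply: contrapT => /not_orP[At AtV].
have [p Ap cVp] := adjoin_excluded At.
have [q Aq cVq] := adjoin_excluded AtV.
apply: (@no_opposite_relations _ t p q (leqnn _) Ap Aq).
- by rewrite -cVp divff.
- by rewrite -cVq divff.
Qed.
End MaximalExclusion.

(** The empty set is admitted only so that the empty chain has an upper
    bound. *)
Lemma valuation_ring_excluding A c : subring A -> A c -> ~ A c^-1 ->
  exists V, [/\ valuation_ring V, (A `<=` V)%classic & ~ V c^-1].
Proof.
move=> sA Ac AcV.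
pose good B := [/\ subring B, (A `<=` B)%classic & ~ B c^-1].
have [|V [[V0|[sV AV VcV]] Vmax]] := @Zorn_bigcup L (fun B => B = set0 \/ good B).
- move=> C Cgood Ctot.
  have [[B0 CB0 [a0 B0a]]|noB] :=
    pselect (exists2 B, C B & (B !=set0)%classic); last first.
    left; rewrite -subset0 => a [B CB Ba]; case: noB.
    by exists B => //; exists a.
  right.
  have gd B a : C B -> B a -> good B.
    by move=> CB Ba; case: (Cgood _ CB) => // B00; rewrite B00 in Ba.
  have [[B01 _ _] AB0 _] := gd _ _ CB0 B0a.
  have two a b :
      (\bigcup_(X in C) X)%classic a -> (\bigcup_(X in C) X)%classic b ->
      exists B, [/\ C B, good B, B a & B b].
    move=> [B CB Ba] [B' CB' B'b].
    have gB := gd _ _ CB Ba; have gB' := gd _ _ CB' B'b.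
    case: (Ctot _ _ CB CB') => sub; first by exists B'; split=> //; apply: sub.
    by exists B; split=> //; apply: sub.
  split.
  + split; first by exists B0.
    * move=> a b Ua Ub; have [B [CB [sB _ _] Ba Bb]] := two _ _ Ua Ub.
      by exists B => //; apply: subringB.
    * move=> a b Ua Ub; have [B [CB [sB _ _] Ba Bb]] := two _ _ Ua Ub.
      by exists B => //; apply: subringM.
  + by move=> a Aa; exists B0 => //; apply: AB0.
  + by move=> [B CB BcV]; have [_ _] := gd _ _ CB BcV; apply.
- case: (Vmax A); last by right; split.
  rewrite V0; split=> [a []//|As0].
  exact: As0 _ Ac.
- exists V; split=> //; apply: (@maximal_exclusion_valuation_ring V c) => //.
    exact: AV.
  move=> B sB VB BcV; apply: contrapT => BV; apply: (Vmax B).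
    split=> // BsubV; apply: BV; by rewrite eqEsubset.
  by right; split=> //; apply: subset_trans VB.
Qed.

End ValuationRings.

(** * From valuation rings to places *)

Section PlaceOfValuation.
Variables (F L : fieldType) (emb : {rmorphism F -> L}) (phi : L -> int).
Hypothesis phiM :
  forall a b : L, a != 0 -> b != 0 -> phi (a * b) = phi a + phi b.
Hypothesis phiD : forall a b : L, a != 0 -> b != 0 -> a + b != 0 ->
  Num.min (phi a) (phi b) <= phi (a + b).
Hypothesis phi_const : forall c : F, phi (emb c) = 0.
Hypothesis phi_nontrivial : exists2 t : L, t != 0 & 0 < phi t.

(** The values form a nonzero subgroup of the integers; dividing by its
    positive generator makes the valuation onto. *)
Lemma normalized_place :
  exists (Q : place emb) (d : int), 0 < d /\ forall z, z != 0 -> phi z = Q z * d.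
Proof.
pose attained (n : nat) := `[< exists2 t : L, t != 0 & phi t = n.+1%:Z >].
have [t0 t0_neq0 t0_gt0] := phi_nontrivial.
have ex_attained : exists n, attained n.
  case E: (phi t0) t0_gt0 => [[|n]|n] // _.
  by exists n; apply/asboolP; exists t0.
case: (ex_minnP ex_attained) => n /asboolP[t t_neq0 phit] n_min.
pose d := n.+1%:Z.
have phi1 : phi 1 = 0 by rewrite -(rmorph1 emb) phi_const.
have phiV z : z != 0 -> phi z^-1 = - phi z.
  move=> z0; apply/eqP; rewrite -addr_eq0 -phiM ?invr_eq0 //.
  by rewrite mulVf ?phi1.
have phiX z k : z != 0 -> phi (z ^+ k) = phi z *+ k.
  move=> z0; elim: k => [|k IH]; first by rewrite expr0 phi1.
  by rewrite exprS phiM ?expf_neq0 // IH mulrS.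
have phiXz z (k : int) : z != 0 -> phi (z ^ k) = phi z * k.
  move=> z0; case: k => k; first by rewrite phiX // pmulrn mulrzz.
  by rewrite NegzE -exprnN phiV ?expf_neq0 // phiX // pmulrn mulrzz mulrN.
(* the remainder of phi z modulo the least positive value is itself a value *)
have d_dvd z : z != 0 -> (d %| phi z)%Z.
  move=> z0; apply/dvdz_mod0P; set r := (phi z %% d)%Z.
  have r_ge0 : 0 <= r by rewrite modz_ge0.
  have r_lt : r < d by rewrite ltz_pmod.
  pose s := z * t ^ (- (phi z %/ d)%Z).
  have s0 : s != 0 by rewrite mulf_neq0 // expfz_neq0.
  have phis : phi s = r.
    rewrite phiM ?expfz_neq0 // phiXz // phit /r -/d /modz.
    by rewrite mulrN [d * _]mulrC.
  case Er: r r_ge0 r_lt phis => [[|k]|k] // _ r_lt phis.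
  have := n_min k; rewrite leqNgt -ltnS -ltz_nat r_lt /=.
  by move=> h; suff : false by []; apply: h; apply/asboolP; exists s.
pose v z := if z == 0 then 0 else (phi z %/ d)%Z.
have vE z : z != 0 -> phi z = v z * d.
  by move=> z0; rewrite /v (negPf z0) divzK // d_dvd.
have d_gt0 : 0 < d by [].
have v0 : v 0 = 0 by rewrite /v eqxx.
have d_neq0 : d != 0 by [].
have vM a b : a != 0 -> b != 0 -> v (a * b) = v a + v b.
  move=> a0 b0; apply: (mulIf d_neq0).
  by rewrite mulrDl -!vE ?mulf_neq0 // phiM.
have vD a b : a != 0 -> b != 0 -> a + b != 0 -> Num.min (v a) (v b) <= v (a + b).
  move=> a0 b0 ab0; rewrite -(ler_pM2r d_gt0) minr_pMl; last exact: ltW.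
  by rewrite -!vE //; apply: phiD.
have v_const a : v (emb a) = 0.
  have [->|a0] := eqVneq a 0; first by rewrite rmorph0.
  by apply: (mulIf d_neq0); rewrite -vE ?fmorph_eq0 // phi_const mul0r.
have v_unif : exists2 t : L, t != 0 & v t = 1.
  by exists t => //; apply: (mulIf d_neq0); rewrite -vE // mul1r.
by exists (Place v0 vM vD v_const v_unif), d.
Qed.
End PlaceOfValuation.

Section PlaceOfValuationRing.
Variables (F L : fieldType) (emb : {rmorphism F -> L}).
Variables (V : set L) (c : L).
Hypotheses (vV : valuation_ring V) (Vc : V c) (VcV : ~ V c^-1).

Definition value_unit z : Prop := [/\ z != 0, V z & V z^-1].

Let sV : subring V := vV.1.

Lemma value_unit1 : value_unit 1.
Proof. by split; rewrite ?oner_eq0 ?invr1 //; apply: subring1. Qed.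

Lemma value_unitM a b : value_unit a -> value_unit b -> value_unit (a * b).
Proof.
move=> [a0 Va VaV] [b0 Vb VbV]; split; first exact: mulf_neq0.
  exact: subringM.
by rewrite invfM; apply: subringM.
Qed.

Lemma value_unitV a : value_unit a -> value_unit a^-1.
Proof. by move=> [a0 Va VaV]; split; rewrite ?invr_eq0 ?invrK. Qed.

Lemma value_unitX a n : value_unit a -> value_unit (a ^+ n).
Proof.
move=> ua; elim: n => [|n IH]; first exact: value_unit1.
by rewrite exprS; apply: value_unitM.
Qed.

(** For a valuation ring V these are exactly the elements of its maximal
    ideal; 0 is listed apart because its inverse is 0 here. *)
Definition nonunit z : Prop := z = 0 \/ ~ V z^-1.

Lemma nonunitM a z : V a -> nonunit z -> nonunit (a * z).
Proof.
move=> Va [->|VzV]; first by rewrite mulr0; left.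
have [->|a0] := eqVneq a 0; first by rewrite mul0r; left.
right; rewrite invfM => h; apply: VzV.
by rewrite -[z^-1](mulVKf a0); apply: subringM.
Qed.

Lemma nonunitD a b : nonunit a -> nonunit b -> nonunit (a + b).
Proof.
case=> [->|na]; first by rewrite add0r.
case=> [->|nb]; first by rewrite addr0; right.
have [->|ab0] := eqVneq (a + b) 0; [by left|right => VabV].
have [b0|b0] := eqVneq b 0; first by apply: nb; rewrite b0 invr0; apply: subring0.
have [a0|a0] := eqVneq a 0; first by apply: na; rewrite a0 invr0; apply: subring0.
have [h|h] := vV.2 (a / b).
  apply: nb; rewrite (_ : b^-1 = (a + b)^-1 * (a / b + 1)).
    by apply: subringM => //; apply: subringD => //; apply: subring1.
  by rewrite -[X in _ / b + X](divff b0) -mulrDl mulKf.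
apply: na; rewrite (_ : a^-1 = (a + b)^-1 * (1 + (a / b)^-1)).
  by apply: subringM => //; apply: subringD => //; apply: subring1.
by rewrite invf_div -[X in X + b / _](divff a0) -mulrDl mulKf.
Qed.

Lemma notin_excluded_neq0 : c != 0.
Proof. by apply/eqP => c0; apply: VcV; rewrite c0 invr0 -c0. Qed.

Lemma value_exprz_ge0 (k : int) : V (c ^ k) <-> 0 <= k.
Proof.
case: k => k; split=> //; first by move=> _; apply: subringX.
rewrite NegzE -exprnN => Vk; case: VcV.
rewrite (_ : c^-1 = c ^+ k * (c ^+ k.+1)^-1); last first.
  by rewrite exprS invfM mulrCA divff ?mulr1 // expf_neq0 ?notin_excluded_neq0.
by apply: subringM => //; apply: subringX.
Qed.

Lemma value_exprz_unit (k : int) : value_unit (c ^ k) -> k = 0.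
Proof.
move=> [_ /value_exprz_ge0 k_ge0].
rewrite invr_expz => /value_exprz_ge0; rewrite oppr_ge0 => k_le0.
by apply/eqP; rewrite eq_le k_le0.
Qed.

(** By hypothesis the value of z is k / M times that of c, so k is an
    integer-valued valuation. *)
Lemma place_of_valuation_ring M : (0 < M)%N ->
    (forall a, V (emb a)) ->
    (forall z, z != 0 -> exists k : int, value_unit (z ^+ M / c ^ k)) ->
  exists Q : place emb, forall z, z != 0 -> (0 <= Q z) <-> V z.
Proof.
move=> M_gt0 emb_V commensurable.
have c_neq0 := notin_excluded_neq0.
have cX_neq0 j : c ^ j != 0 by rewrite expfz_neq0.
have : forall z, exists k : int,
    (z = 0 -> k = 0) /\ (z != 0 -> value_unit (z ^+ M / c ^ k)).
  move=> z; have [->|z0] := eqVneq z 0; first by exists 0.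
  have [k hk] := commensurable z z0.
  by exists k; split=> // /eqP; rewrite (negPf z0).
move=> /choice [phi phi_spec].
have phiP z : z != 0 -> value_unit (z ^+ M / c ^ phi z) by have [] := phi_spec z.
have phi_uniq z k : z != 0 -> value_unit (z ^+ M / c ^ k) -> phi z = k.
  move=> z0 uk; apply/eqP; rewrite eq_sym -subr_eq0; apply/eqP.
  apply: value_exprz_unit.
  rewrite (_ : c ^ _ = z ^+ M / c ^ phi z * (z ^+ M / c ^ k)^-1).
    by apply: value_unitM; [apply: phiP|apply: value_unitV].
  rewrite expfzDr // -invr_expz invfM invrK mulrACA divff ?expf_neq0 //.
  by rewrite mul1r mulrC.
have phiM a b : a != 0 -> b != 0 -> phi (a * b) = phi a + phi b.
  move=> a0 b0; apply: phi_uniq; first exact: mulf_neq0.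
  rewrite expfzDr // exprMn invfM mulrACA.
  by apply: value_unitM; apply: phiP.
have phi_ge0 z : z != 0 -> V z <-> 0 <= phi z.
  move=> z0; have [u0 Vu VuV] := phiP _ z0.
  have zM_V : V (z ^+ M) <-> V (c ^ phi z).
    split=> h.
      rewrite (_ : c ^ _ = z ^+ M * (z ^+ M / c ^ phi z)^-1).
        exact: subringM.
      by rewrite invfM invrK mulVKf ?expf_neq0.
    by rewrite -[z ^+ M](divfK (cX_neq0 (phi z))); apply: subringM.
  split=> [Vz|]; first by apply/value_exprz_ge0/zM_V; apply: subringX.
  move=> /value_exprz_ge0/zM_V VzM.
  case: (vV.2 z) => // VzV.
  rewrite (_ : z = z ^+ M * z^-1 ^+ M.-1).
    by apply: subringM => //; apply: subringX.
  by rewrite -{1}(prednK M_gt0) exprS exprVn mulfK // expf_neq0.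
have phi1 : phi 1 = 0.
  apply: phi_uniq; rewrite ?oner_eq0 // expr1n expr0z divr1.
  exact: value_unit1.
have phiV z : z != 0 -> phi z^-1 = - phi z.
  move=> z0; apply/eqP; rewrite -addr_eq0 -phiM ?invr_eq0 //.
  by rewrite mulVf ?phi1.
have phi_const a : phi (emb a) = 0.
  have [->|a0] := eqVneq a 0; first by rewrite rmorph0; apply: (phi_spec 0).1.
  have ea0 : emb a != 0 by rewrite fmorph_eq0.
  have /phi_ge0-/(_ ea0) le1 := emb_V a.
  have := emb_V a^-1; rewrite fmorphV => /phi_ge0.
  rewrite invr_eq0 => /(_ ea0); rewrite phiV // oppr_ge0 => le2.
  by apply/eqP; rewrite eq_le le1 le2.
have phiD a b : a != 0 -> b != 0 -> a + b != 0 ->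
    Num.min (phi a) (phi b) <= phi (a + b).
  wlog le_ab : a b / phi a <= phi b.
    move=> IH a0 b0 ab0; have [le_ab|/ltW le_ba] := leP (phi a) (phi b).
      by have := IH a b le_ab a0 b0 ab0; rewrite (min_idPl le_ab).
    rewrite addrC; rewrite addrC in ab0.
    by have := IH b a le_ba b0 a0 ab0; rewrite (min_idPl le_ba).
  move=> a0 b0 ab0; rewrite (min_idPl le_ab).
  have ba0 : b / a != 0 by rewrite mulf_neq0 ?invr_eq0.
  have abE : a + b = a * (1 + b / a) by rewrite mulrDr mulr1 mulrCA divff ?mulr1.
  have ba1 : 1 + b / a != 0 by apply: contraNneq ab0 => h; rewrite abE h mulr0.
  rewrite abE phiM // lerDl; apply/phi_ge0 => //.
  apply: subringD => //; first exact: subring1.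
  by apply/phi_ge0 => //; rewrite phiM ?invr_eq0 // phiV // subr_ge0.
have phi_c : phi c = M.
  apply: phi_uniq => //; rewrite -exprnP divff ?expf_neq0 //.
  exact: value_unit1.
have phi_pos : exists2 t : L, t != 0 & 0 < phi t.
  by exists c => //; rewrite phi_c ltz_nat.
have [Q [d [d_gt0 QE]]] :=
  @normalized_place _ _ emb phi phiM phiD phi_const phi_pos.
by exists Q => z z0; rewrite phi_ge0 // QE // pmulr_lge0.
Qed.

(** The term of least value cannot be alone: dividing by it would write -1 as
    a sum of elements of the maximal ideal of V. *)
Lemma vanishing_sum_unit_ratio n (f : 'I_n -> L) i0 :
    f i0 != 0 -> \sum_i f i = 0 ->
  exists i j, [/\ i != j, f i != 0, f j != 0 & value_unit (f i / f j)].
Proof.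
move=> fi0 sumf0.
have dominant (s : seq L) : has (fun a => a != 0) s ->
    exists a, [/\ a \in s, a != 0 & forall b, b \in s -> V (b / a)].
  elim: s => // a s IH /=.
  have [->|a0] := eqVneq a 0.
    move=> /= /IH [b [bs b0 bmax]].
    exists b; split=> //; first by rewrite inE bs orbT.
    move=> e; rewrite inE => /orP[/eqP->|/bmax //].
    by rewrite mul0r; apply: subring0.
  have Vaa : V (a / a) by rewrite divff //; apply: subring1.
  have [/IH [b [bs b0 bmax]] _|/hasPn s0 _] := boolP (has (fun a => a != 0) s).
    have [Vab|] := vV.2 (a / b).
      exists b; split=> //; first by rewrite inE bs orbT.
      by move=> e; rewrite inE => /orP[/eqP->|/bmax].
    rewrite invf_div => Vba; exists a; split=> //; first exact: mem_head.
    move=> e; rewrite inE => /orP[/eqP-> //|/bmax Veb].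
    rewrite (_ : e / a = e / b * (b / a)); last by rewrite mulrA divfK.
    exact: subringM.
  exists a; split=> //; first exact: mem_head.
  move=> e; rewrite inE => /orP[/eqP-> //|/s0].
  by rewrite negbK => /eqP->; rewrite mul0r; apply: subring0.
have [|a [/mapP[j _ ->] fj0 fj_max]] := dominant [seq f i | i <- enum 'I_n].
  by apply/hasP; exists (f i0) => //; apply: map_f; rewrite mem_enum.
apply: contrapT => alone.
have : nonunit (\sum_(i | i != j) f i / f j).
  apply: big_ind => [|u v|i ij]; [by left|exact: nonunitD|].
  have Vij : V (f i / f j) by apply: fj_max; apply: map_f; rewrite mem_enum.
  have [->|fi_neq0] := eqVneq (f i) 0; first by rewrite mul0r; left.
  right=> VijV; apply: alone; exists i, j; split=> //; split=> //.
  by rewrite mulf_neq0 // invr_eq0.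
have -> : \sum_(i | i != j) f i / f j = - 1.
  apply/eqP; rewrite -addr_eq0 addrC; apply/eqP.
  transitivity (\sum_i f i / f j); last by rewrite -mulr_suml sumf0 mul0r.
  by rewrite [RHS](bigD1 j) //= divff.
case=> [/eqP|]; first by rewrite oppr_eq0 oner_eq0.
by apply; rewrite invrN1; apply: subringN => //; apply: subring1.
Qed.

(** Two terms p_i z^i and p_j z^j of the vanishing sum p(z) have the same
    value, so z^(i-j) has the value of an element of K; the exponent N!
    is a multiple of i - j whatever these indices are. *)
Lemma commensurable_root (K : set L) (p : {poly L}) z N :
    (forall a, K a -> a != 0 -> exists k : int, value_unit (a / c ^ k)) ->
    (forall i, K p`_i) -> p != 0 -> (size p <= N.+1)%N -> root p z -> z != 0 ->
  exists k : int, value_unit (z ^+ N`! / c ^ k).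
Proof.
move=> K_val Kp p0 szp /eqP pz0 z0.
have c_neq0 := notin_excluded_neq0.
have cX_neq0 j : c ^ j != 0 by rewrite expfz_neq0.
have lead_lt : ((size p).-1 < size p)%N by rewrite prednK // size_poly_gt0.
have [||i [j [ij]]] := @vanishing_sum_unit_ratio (size p)
    (fun i => p`_i * z ^+ i) (Ordinal lead_lt).
- by rewrite /= mulf_neq0 ?expf_neq0 // -lead_coefE lead_coef_eq0.
- by rewrite -horner_coef.
wlog lt_ij : i j ij / (j < i)%N.
  move=> IH fi0 fj0 uij; case: (ltngtP i j) => [lt|lt|/val_inj e].
  - apply: (IH j i) => //; first by rewrite eq_sym.
    by rewrite -invf_div; apply: value_unitV.
  - exact: (IH i j).
  - by rewrite e eqxx in ij.
rewrite !mulf_eq0 !negb_or => /andP[pi0 _] /andP[pj0 _] uij.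
have [ki uki] := K_val _ (Kp i) pi0.
have [kj ukj] := K_val _ (Kp j) pj0.
pose e := (i - j)%N.
have ue : value_unit (z ^+ e / c ^ (kj - ki)).
  rewrite (_ : _ / _ = p`_i * z ^+ i / (p`_j * z ^+ j)
                         * (p`_j / c ^ kj) * (p`_i / c ^ ki)^-1).
    by apply: value_unitM; [apply: value_unitM|apply: value_unitV].
  rewrite /e expfB // expfzDr // -invr_expz !invfM !invrK.
  by field; rewrite ?pi0 ?pj0 ?cX_neq0 ?expf_neq0.
have e_dvd : (e %| N`!)%N.
  apply: dvdn_fact; rewrite /e subn_gt0 lt_ij /=.
  rewrite (leq_trans (leq_subr _ _)) // -ltnS (leq_trans (ltn_ord i)) //.
exists ((kj - ki) * (N`! %/ e)%N%:Z).
rewrite -exprz_exp -exprnP -{1}(divnK e_dvd) mulnC exprM -exprVn -exprMn.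
exact: value_unitX.
Qed.

End PlaceOfValuationRing.

(** * Orders of functions at places *)

Section PlaceTheory.
Variables (F L : fieldType) (emb : {rmorphism F -> L}).
Implicit Types (Q : place emb) (f g : L).

Lemma ord_at1 Q : Q 1 = 0.
Proof. by rewrite -(rmorph1 emb) ord_at_const. Qed.

Lemma ord_atV Q f : Q f^-1 = - Q f.
Proof.
have [->|f0] := eqVneq f 0; first by rewrite invr0 ord_at0 oppr0.
by apply/eqP; rewrite -addr_eq0 -ord_atM ?invr_eq0 // mulVf ?ord_at1.
Qed.

Lemma ord_atX Q f n : f != 0 -> Q (f ^+ n) = Q f *+ n.
Proof.
move=> f0; elim: n => [|n IH]; first by rewrite expr0 ord_at1.
by rewrite exprS ord_atM ?expf_neq0 // IH mulrS.
Qed.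

Lemma ord_atM_ge0 Q f g : 0 <= Q f -> 0 <= Q g -> 0 <= Q (f * g).
Proof.
have [->|f0] := eqVneq f 0; first by rewrite mul0r.
have [->|g0] := eqVneq g 0; first by rewrite mulr0.
by rewrite ord_atM //; apply: addr_ge0.
Qed.

Lemma ord_atD_ge0 Q f g : 0 <= Q f -> 0 <= Q g -> 0 <= Q (f + g).
Proof.
have [->|f0] := eqVneq f 0; first by rewrite add0r.
have [->|g0] := eqVneq g 0; first by rewrite addr0.
have [->|fg0] := eqVneq (f + g) 0; first by rewrite ord_at0.
by move=> Qf Qg; apply: le_trans (ord_atD Q f0 g0 fg0); rewrite le_min Qf.
Qed.

Lemma ord_at_sum_ge0 Q I (r : seq I) (B : pred I) (f : I -> L) :
  (forall i, B i -> 0 <= Q (f i)) -> 0 <= Q (\sum_(i <- r | B i) f i).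
Proof.
move=> Qf; apply: (big_ind (fun z => 0 <= Q z)) => //; first by rewrite ord_at0.
exact: ord_atD_ge0.
Qed.

Lemma ord_atN Q f : Q (- f) = Q f.
Proof.
have [->|f0] := eqVneq f 0; first by rewrite oppr0.
rewrite -mulN1r ord_atM ?oppr_eq0 ?oner_eq0 //.
by rewrite -(rmorph1 emb) -rmorphN ord_at_const add0r.
Qed.

Lemma ord_atD_lt Q f g : f != 0 -> g != 0 -> Q f < Q g ->
  f + g != 0 /\ Q (f + g) = Q f.
Proof.
move=> f0 g0 lt_fg.
have fg0 : f + g != 0.
  apply: contraTneq lt_fg => /eqP; rewrite addr_eq0 => /eqP->.
  by rewrite ord_atN ltxx.
split=> //; apply/eqP; rewrite eq_le.
have := ord_atD Q f0 g0 fg0; rewrite (min_idPl (ltW lt_fg)) => ->.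
have Ng0 : - g != 0 by rewrite oppr_eq0.
have := ord_atD Q fg0 Ng0; rewrite addrK ord_atN => /(_ f0).
by rewrite ge_min [Q g <= _]leNgt lt_fg orbF => ->.
Qed.

(** The strict triangle inequality singles out the term of least order. *)
Lemma ord_at_sum_distinct Q (I : eqType) (r : seq I) (f : I -> L) : uniq r ->
    (forall i j, i \in r -> j \in r -> f i != 0 -> f j != 0 ->
      Q (f i) = Q (f j) -> i = j) ->
    \sum_(i <- r) f i != 0 ->
  exists i, [/\ i \in r, f i != 0 & Q (\sum_(i <- r) f i) = Q (f i)].
Proof.
elim: r => [|i r IH] /=; first by rewrite big_nil eqxx.
move=> /andP[ir ur] f_inj; rewrite big_cons.
set t := \sum_(j <- r) f j.
have {}IH : t != 0 -> exists j, [/\ j \in r, f j != 0 & Q t = Q (f j)].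
  by apply: IH => // j k jr kr; apply: f_inj; rewrite inE ?jr ?kr orbT.
have [fi0|fi0] := eqVneq (f i) 0.
  rewrite fi0 add0r => /IH [j [jr fj0 tE]].
  by exists j; rewrite inE jr orbT.
have [t0|t0] := eqVneq t 0; first by rewrite t0 addr0; exists i; rewrite mem_head.
move=> _; have [j [jr fj0 tE]] := IH t0.
have jr' : j \in i :: r by rewrite inE jr orbT.
have : Q (f i) != Q t.
  apply: contraNneq ir; rewrite tE => /(f_inj i j (mem_head _ _) jr' fi0 fj0) ->.
  exact: jr.
rewrite neq_lt => /orP[lt_it|lt_ti].
  by exists i; rewrite mem_head (ord_atD_lt fi0 t0 lt_it).2.
by exists j; rewrite jr' addrC (ord_atD_lt t0 fi0 lt_ti).2 tE.
Qed.

Definition pev (u : L) : {poly F} -> L := horner_eval u \o map_poly emb.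
HB.instance Definition _ u :=
  GRing.RMorphism.copy (pev u) (horner_eval u \o map_poly emb).

Lemma pevE u p : pev u p = \sum_(i < size p) emb p`_i * u ^+ i.
Proof.
rewrite /pev /= horner_evalE horner_coef size_map_poly.
by apply: eq_bigr => i _; rewrite coef_map.
Qed.

Lemma pevC u a : pev u a%:P = emb a.
Proof. by rewrite /pev /= horner_evalE map_polyC hornerC. Qed.

Lemma pevX u : pev u 'X = u.
Proof. by rewrite /pev /= horner_evalE map_polyX hornerX. Qed.

Lemma ord_pev_ge0 Q u p : 0 <= Q u -> 0 <= Q (pev u p).
Proof.
move=> Qu; rewrite pevE; apply: ord_at_sum_ge0 => i _.
apply: ord_atM_ge0; first by rewrite ord_at_const.
have [->|u0] := eqVneq u 0; last by rewrite ord_atX // mulrn_wge0.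
by case: (i : nat) => [|k]; rewrite ?expr0 ?ord_at1 // expr0n ord_at0.
Qed.

(** At a pole of u the leading term dominates, hence such a u is
    transcendental over F and the order of a polynomial in u is proportional
    to its degree. *)
Lemma ord_pev_pole Q u p : Q u < 0 -> p != 0 ->
  pev u p != 0 /\ Q (pev u p) = Q u *+ (size p).-1.
Proof.
move=> Qu; have u0 : u != 0 by apply: contraTneq Qu => ->; rewrite ord_at0.
elim/poly_ind: p => [|p c IH]; first by rewrite eqxx.
rewrite size_MXaddC rmorphD rmorphM /= pevX pevC.
have [->|p0] := eqVneq p 0.
  rewrite rmorph0 !mul0r !add0r polyC_eq0 size_poly0 /= => c0.
  by rewrite (negPf c0) mulr0n fmorph_eq0 c0 ord_at_const.
have [pu0 Qp] := IH p0; move=> _ /=.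
have pu_neq0 : pev u p * u != 0 by rewrite mulf_neq0.
have Qpu : Q (pev u p * u) = Q u *+ size p.
  by rewrite ord_atM // Qp -mulrSr prednK // size_poly_gt0.
have [->|c0] := eqVneq c 0; first by rewrite rmorph0 addr0.
rewrite -Qpu; apply: ord_atD_lt => //; first by rewrite fmorph_eq0.
by rewrite Qpu ord_at_const mulrn_wlt0 // size_poly_gt0.
Qed.

Definition in_Fu u : set L :=
  [set z | exists a b : {poly F}, b != 0 /\ z = pev u a / pev u b]%classic.

(** * Places above the u-line *)

Section PlacesOverLine.
Variables (u : L) (N : nat).
Hypothesis u_transc : forall p, pev u p = 0 -> p = 0.
Hypothesis Fu_root : forall z, exists p : {poly L},
  [/\ p != 0, forall i, in_Fu u p`_i, (size p <= N.+1)%N & root p z].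

Let pev_neq0 p : p != 0 -> pev u p != 0.
Proof. by apply: contraNneq => /u_transc ->. Qed.

Lemma in_Fu_reduced z : in_Fu u z ->
  exists a b, [/\ coprimep a b, b != 0 & z = pev u a / pev u b].
Proof.
move=> [a0 [b0 [b0_neq0 zE]]].
pose g := gcdp a0 b0; pose a := a0 %/ g; pose b := b0 %/ g.
have g_neq0 : g != 0 by rewrite gcdp_eq0 negb_and b0_neq0 orbT.
have a0E : a0 = a * g by rewrite divpK // dvdp_gcdl.
have b0E : b0 = b * g by rewrite divpK // dvdp_gcdr.
exists a, b; split.
- by apply: coprimep_div_gcd; rewrite b0_neq0 orbT.
- by apply: contraNneq b0_neq0; rewrite b0E => ->; rewrite mul0r.
- by rewrite zE a0E b0E !rmorphM /= -mulf_div divff ?mulr1 ?pev_neq0.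
Qed.

(** In a valuation ring V that contains F[u] but not 1 / b(u), the polynomial
    pi of least degree whose value at u is a non-unit generates the prime
    ideal of F[u] below the maximal ideal; thus every element of F (u) is a
    power of pi (u) up to a unit of V. *)
Lemma place_over_polynomial (b : {poly F}) : (1 < size b)%N ->
  exists Q : place emb, 0 <= Q u /\ 0 < Q (pev u b).
Proof.
move=> szb; pose A0 : set L := [set pev u a | a in setT]%classic.
have b0 : b != 0 by rewrite -size_poly_gt0 ltnW.
have sA0 : subring A0.
  split; first by exists 1; rewrite ?rmorph1.
  - by move=> _ _ [a _ <-] [a' _ <-]; exists (a - a'); rewrite ?rmorphB.
  - by move=> _ _ [a _ <-] [a' _ <-]; exists (a * a'); rewrite ?rmorphM.
have A0bV : ~ A0 (pev u b)^-1.
  case=> a _ ab.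
  have /u_transc/eqP : pev u (a * b - 1) = 0.
    by rewrite rmorphB rmorphM rmorph1 /= ab mulVf ?subrr ?pev_neq0.
  rewrite subr_eq0 => /eqP/(congr1 (fun p : {poly F} => size p)).
  have a0 : a != 0.
    apply/eqP => a0; move: ab; rewrite a0 rmorph0 => /esym/eqP.
    by rewrite invr_eq0 (negPf (pev_neq0 b0)).
  rewrite size_mul // size_poly1 => sz; move: szb a0.
  rewrite -size_poly_gt0; move: sz; move: (size a) (size b) => k l; lia.
have A0b : A0 (pev u b) by exists b.
have [V [vV A0V VbV]] := valuation_ring_excluding sA0 A0b A0bV.
have sV := vV.1.
have Vpev a : V (pev u a) by apply: A0V; exists a.
pose bad n := `[< exists2 a : {poly F}, size a = n & ~ V (pev u a)^-1 >].
have ex_bad : exists n, bad n by exists (size b); apply/asboolP; exists b.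
case: (ex_minnP ex_bad) => n /asboolP[pi szpi VpiV] n_min.
have small_unit (r : {poly F}) : (size r < n)%N -> V (pev u r)^-1.
  move=> szr; apply: contrapT => nV; move: szr; rewrite ltnNge n_min //.
  by apply/asboolP; exists r.
set c := pev u pi in VpiV.
have Vc : V c by apply: Vpev.
have c0 : c != 0 := notin_excluded_neq0 Vc VpiV.
have pi0 : pi != 0 by apply: contraNneq c0; rewrite /c => ->; rewrite rmorph0.
have poly_val (a : {poly F}) : a != 0 ->
    exists k : int, value_unit V (pev u a / c ^ k).
  have [m] := ubnP (size a); elim: m a => // m IH a sza a0.
  have [VaV|VaV] := pselect (V (pev u a)^-1).
    by exists 0; rewrite expr0z divr1; split=> //; apply: pev_neq0.
  have [r0|r0] := eqVneq (a %% pi) 0.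
    have aE : a = a %/ pi * pi by rewrite {1}(divp_eq a pi) r0 addr0.
    have q0 : a %/ pi != 0 by apply: contraNneq a0 => q0; rewrite aE q0 mul0r.
    have [|k uk] := IH (a %/ pi) _ q0.
      apply: leq_trans (_ : size a <= m)%N => //.
      rewrite {2}aE size_mul //.
      have : (1 < size pi)%N.
        rewrite ltnNge; apply/negP => /size1_polyC pi_const.
        by apply: VpiV; rewrite /c pi_const pevC -fmorphV -(pevC u).
      case: (size pi) => [|[|k]] // _; rewrite !addnS /= ltnS.
      exact: leq_addr.
    exists (k + 1); rewrite {1}aE rmorphM /= expfzDr // expr1z -/c.
    by rewrite invfM mulrACA divff // mulr1.
  exfalso.
  have nr : nonunit V (pev u (a %% pi)).
    have -> : a %% pi = a + - (a %/ pi) * pi.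
      by rewrite {2}(divp_eq a pi) mulNr addrAC subrr add0r.
    rewrite rmorphD rmorphM /=; apply: nonunitD => //; first by right.
    by apply: nonunitM => //; right.
  case: nr => [/u_transc/eqP|]; first by rewrite (negPf r0).
  by apply; apply: small_unit; rewrite -szpi ltn_modp.
have Fu_val z : in_Fu u z -> z != 0 -> exists k : int, value_unit V (z / c ^ k).
  move=> [a [d [d0 ->]]] z0.
  have a0 : a != 0 by apply: contraNneq z0 => ->; rewrite rmorph0 mul0r.
  have [k uk] := poly_val _ a0; have [l ul] := poly_val _ d0.
  exists (k - l); rewrite expfzDr // invfM -invr_expz invrK.
  rewrite (_ : _ * _ = pev u a / c ^ k * (pev u d / c ^ l)^-1).
    by apply: value_unitM => //; apply: value_unitV.
  by rewrite [in RHS]invfM invrK mulrACA.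
have [||Q QV] := @place_of_valuation_ring _ _ emb V c vV Vc VpiV _ (fact_gt0 N).
- by move=> a; rewrite -(pevC u).
- move=> z z0; have [p [p0 Kp szp pz]] := Fu_root z.
  exact: (commensurable_root _ _ _ Fu_val Kp p0 szp pz z0).
have bu0 := pev_neq0 b0.
exists Q; split.
  have [->|u0] := eqVneq u 0; first by rewrite ord_at0.
  by apply/QV => //; rewrite -(pevX u).
rewrite lt_neqAle; apply/andP; split; last by apply/QV.
apply/eqP => Qb; apply: VbV; apply/QV; first by rewrite invr_eq0.
by rewrite ord_atV -Qb oppr0.
Qed.

Variable P : place emb.
Hypothesis u_pole : P u < 0.

(** If a reduced fraction a / b were not a polynomial, a place above a zero of
    b would be a pole, and it is not P because u has no pole there. *)
Lemma regular_in_Fu_polynomial z : in_Fu u z ->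
  (forall Q, Q <> P -> 0 <= Q z) -> exists p, z = pev u p.
Proof.
move=> /in_Fu_reduced [a [b [co_ab b_neq0 zE]]] Qz.
have [szb|szb] := ltnP 1 (size b); last first.
  have bE := size1_polyC szb; exists (a * (b`_0)^-1%:P).
  by rewrite zE {1}bE rmorphM /= !pevC fmorphV.
have [Q [Qu Qb]] := place_over_polynomial szb.
have QP : Q <> P by move=> E; move: u_pole; rewrite -E ltNge Qu.
have /Bezout_eq1_coprimepP [[s t] /= st1] := co_ab.
have bu0 := pev_neq0 b_neq0.
have: 0 < Q 1.
  have -> : 1 = pev u b * (pev u s * z + pev u t).
    rewrite mulrDr mulrCA zE [pev u b * (_ / _)]mulrC divfK //.
    by rewrite -!rmorphM -rmorphD /= [b * t]mulrC st1 rmorph1.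
  have h : 0 <= Q (pev u s * z + pev u t).
    apply: ord_atD_ge0; last exact: ord_pev_ge0.
    by apply: ord_atM_ge0; [exact: ord_pev_ge0|exact: Qz].
  have [w0|w0] := eqVneq (pev u s * z + pev u t) 0.
    exfalso; have /eqP := congr1 (pev u) st1.
    rewrite rmorphD !rmorphM rmorph1 /=.
    have -> : pev u a = z * pev u b by rewrite zE divfK.
    by rewrite mulrA -mulrDl w0 mul0r eq_sym oner_eq0.
  by rewrite ord_atM // ltr_wpDr.
by rewrite ord_at1.
Qed.

End PlacesOverLine.
End PlaceTheory.

(** * The field F (u) *)

Section FractionsInU.
Variables (F L : fieldType) (emb : {rmorphism F -> L}) (u : L).
Hypothesis u_transc : forall p, pev emb u p = 0 -> p = 0.
Local Notation inFu := (in_Fu emb u).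
Local Notation pev := (pev emb u).

Let pev_neq0 p : p != 0 -> pev p != 0.
Proof. by apply: contraNneq => /u_transc ->. Qed.

Lemma in_Fu_pev p : inFu (pev p).
Proof. by exists p, 1; rewrite oner_eq0 rmorph1 divr1. Qed.

Lemma in_Fu_const a : inFu (emb a).
Proof. by rewrite -(pevC emb u); apply: in_Fu_pev. Qed.

Lemma in_FuM z w : inFu z -> inFu w -> inFu (z * w).
Proof.
move=> [a [b [b0 ->]]] [a' [b' [b'0 ->]]]; exists (a * a'), (b * b').
by rewrite mulf_neq0 // !rmorphM /= mulf_div.
Qed.

Lemma in_FuV z : inFu z -> inFu z^-1.
Proof.
move=> [a [b [b0 ->]]]; have [->|a0] := eqVneq a 0.
  by rewrite rmorph0 mul0r invr0 -(rmorph0 emb); apply: in_Fu_const.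
by exists b, a; rewrite invf_div.
Qed.

Lemma in_FuD z w : inFu z -> inFu w -> inFu (z + w).
Proof.
move=> [a [b [b0 ->]]] [a' [b' [b'0 ->]]].
exists (a * b' + a' * b), (b * b'); rewrite mulf_neq0 //; split=> //.
by rewrite rmorphD !rmorphM /= addf_div // pev_neq0.
Qed.

Lemma in_Fu_sum I (r : seq I) (B : pred I) (f : I -> L) :
  (forall i, B i -> inFu (f i)) -> inFu (\sum_(i <- r | B i) f i).
Proof.
move=> h; apply: (big_ind inFu) => //; last exact: in_FuD.
by rewrite -(rmorph0 emb); apply: in_Fu_const.
Qed.

Lemma in_FuX z n : inFu z -> inFu (z ^+ n).
Proof.
move=> h; elim: n => [|n IH]; last by rewrite exprS; apply: in_FuM.
by rewrite expr0 -(rmorph1 emb); apply: in_Fu_const.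
Qed.
End FractionsInU.

(** * Morphisms of function fields of plane curves *)

Section FunctionFieldMorphism.
Variables (F L : fieldType) (emb : {rmorphism F -> L}) (x y x' y' : L).

Lemma eval2E g a b :
  eval2 emb g a b = \sum_(i < size g) pev emb b g`_i * a ^+ i.
Proof.
rewrite /eval2 [X in X.[b]]horner_coef horner_sum.
rewrite size_map_inj_poly ?rmorph0 //; last exact: map_poly_inj.
apply: eq_bigr => i _; rewrite coef_map /= hornerM.
by rewrite -rmorphXn hornerC.
Qed.

Let ev2 a b : {rmorphism {poly {poly F}} -> L} :=
  horner_eval b \o horner_eval a%:P \o map_poly (map_poly emb).

Lemma eval2M g h a b : eval2 emb (g * h) a b = eval2 emb g a b * eval2 emb h a b.
Proof. exact: (rmorphM (ev2 a b)). Qed.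
Lemma eval2B g h a b : eval2 emb (g - h) a b = eval2 emb g a b - eval2 emb h a b.
Proof. exact: (rmorphB (ev2 a b)). Qed.
Lemma eval2D g h a b : eval2 emb (g + h) a b = eval2 emb g a b + eval2 emb h a b.
Proof. exact: (rmorphD (ev2 a b)). Qed.
Lemma eval2_1 a b : eval2 emb 1 a b = 1.
Proof. exact: (rmorph1 (ev2 a b)). Qed.
Lemma eval2Xn g n a b : eval2 emb (g ^+ n) a b = eval2 emb g a b ^+ n.
Proof. exact: (rmorphXn (ev2 a b)). Qed.
Lemma eval2X a b : eval2 emb 'X a b = a.
Proof. by rewrite /eval2 map_polyX hornerX hornerC. Qed.
Lemma eval2C p a b : eval2 emb p%:P a b = pev emb b p.
Proof. by rewrite /eval2 map_polyC /= hornerC. Qed.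

Definition scaleY (c : F) (g : {poly {poly F}}) : {poly {poly F}} :=
  map_poly (comp_poly (c *: 'X)) g.

Lemma eval2_scaleY c g a b :
  eval2 emb (scaleY c g) a b = eval2 emb g a (emb c * b).
Proof.
elim/poly_ind: g => [|g p IH].
  by rewrite /scaleY rmorph0 /eval2 !rmorph0 !horner0.
rewrite /scaleY rmorphD rmorphM /= map_polyX map_polyC /= -/(scaleY c g).
rewrite !eval2D !eval2M !eval2X !eval2C IH; congr (_ + _).
rewrite /pev /= !horner_evalE map_comp_poly horner_comp map_polyZ map_polyX.
by rewrite hornerZ hornerX.
Qed.

Lemma eval2_rmorph (s : {rmorphism L -> L}) g a b :
  (forall c, s (emb c) = emb c) -> s (eval2 emb g a b) = eval2 emb g (s a) (s b).
Proof.
move=> s_const; rewrite !eval2E rmorph_sum; apply: eq_bigr => i _.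
rewrite rmorphM rmorphXn /=; congr (_ * _).
rewrite !pevE rmorph_sum; apply: eq_bigr => k _.
by rewrite rmorphM rmorphXn /= s_const.
Qed.

Hypothesis same_relations :
  forall g, eval2 emb g x y = 0 <-> eval2 emb g x' y' = 0.
Hypothesis fractions : forall z, exists g h,
  eval2 emb h x y != 0 /\ z = eval2 emb g x y / eval2 emb h x y.

(** L is generated by x and y, so sending them to another pair of elements of
    L with the same algebraic relations defines an endomorphism; fractions are
    mapped by choosing a numerator and a denominator. *)
Lemma function_field_morphism :
  exists s : {rmorphism L -> L},
    forall g, s (eval2 emb g x y) = eval2 emb g x' y'.
Proof.
have : forall z, exists gh : {poly {poly F}} * {poly {poly F}},
    eval2 emb gh.2 x y != 0 /\ z = eval2 emb gh.1 x y / eval2 emb gh.2 x y.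
  by move=> z; have [g [h gh]] := fractions z; exists (g, h).
move=> /choice [num_den ndP].
pose s z := eval2 emb (num_den z).1 x' y' / eval2 emb (num_den z).2 x' y'.
have nz' h : eval2 emb h x y != 0 -> eval2 emb h x' y' != 0.
  by apply: contraNneq => /same_relations ->.
have sE g h : eval2 emb h x y != 0 ->
    s (eval2 emb g x y / eval2 emb h x y) = eval2 emb g x' y' / eval2 emb h x' y'.
  move=> h0; rewrite /s; set z := eval2 emb g x y / eval2 emb h x y.
  have [d0 zE] := ndP z.
  set n := (num_den z).1 in zE *; set d := (num_den z).2 in d0 zE *.
  apply/eqP; rewrite eqr_div ?nz' // -subr_eq0 -!eval2M -eval2B.
  apply/eqP/same_relations; apply/eqP.
  by rewrite eval2B !eval2M subr_eq0 -eqr_div // -zE.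
have split_frac z : exists g h,
  [/\ eval2 emb h x y != 0, z = eval2 emb g x y / eval2 emb h x y
    & s z = eval2 emb g x' y' / eval2 emb h x' y'].
  by have [g [h [h0 zE]]] := fractions z; exists g, h; rewrite {2}zE sE.
have s_poly g : s (eval2 emb g x y) = eval2 emb g x' y'.
  have := sE g 1; rewrite !eval2_1 !divr1; apply; exact: oner_neq0.
have sB : zmod_morphism s.
  move=> a b; have [g [h [h0 aE ->]]] := split_frac a.
  have [g' [h' [h'0 bE ->]]] := split_frac b.
  rewrite aE bE -mulNr addf_div // -mulNr addf_div ?nz' // !mulNr.
  by rewrite -!eval2M -!eval2B sE // eval2M mulf_neq0.
have sM : monoid_morphism s.
  split; first by have := s_poly 1; rewrite !eval2_1.
  move=> a b; have [g [h [h0 aE ->]]] := split_frac a.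
  have [g' [h' [h'0 bE ->]]] := split_frac b.
  by rewrite aE bE !mulf_div -!eval2M sE // eval2M mulf_neq0.
pose sZ := GRing.isZmodMorphism.Build L L s sB.
pose sR := GRing.isMonoidMorphism.Build L L s sM.
pose S : {rmorphism L -> L} := HB.pack s sZ sR.
by exists S.
Qed.
End FunctionFieldMorphism.

(** * A cyclic group acting on a field *)

Lemma big_ord_cyclic_shift (R : Type) (idx : R) (op : Monoid.com_law idx)
    (f : nat -> R) n : f n = f 0%N ->
  \big[op/idx]_(j < n) f j.+1 = \big[op/idx]_(j < n) f j.
Proof.
case: n => [|n] fn; first by rewrite !big_ord0.
by rewrite big_ord_recr big_ord_recl /= fn Monoid.mulmC.
Qed.

Section CyclicAction.
Variables (F L : fieldType) (emb : {rmorphism F -> L}) (s : {rmorphism L -> L}).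
Variables (N : nat) (eta : F).
Hypothesis eta_prim : N.-primitive_root eta.
Hypothesis s_const : forall c, s (emb c) = emb c.
Hypothesis s_order : forall z, iter N s z = z.

Let N_gt0 : (0 < N)%N := prim_order_gt0 eta_prim.

Let N_neq0 : N%:R != 0 :> L.
Proof.
by rewrite -(rmorph_nat emb) fmorph_eq0 (prim_root_natf_neq0 eta_prim).
Qed.

Let eta0 : emb eta != 0.
Proof.
rewrite fmorph_eq0; apply/eqP => e0; have /eqP := prim_expr_order eta_prim.
by rewrite e0 expr0n gtn_eqF // eq_sym oner_eq0.
Qed.

Lemma iter_rmorphM j a b : iter j s (a * b) = iter j s a * iter j s b.
Proof. by elim: j => //= j ->; rewrite rmorphM. Qed.

Lemma iter_rmorph_sum j n (f : 'I_n -> L) :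
  iter j s (\sum_i f i) = \sum_i iter j s (f i).
Proof. by elim: j => //= j ->; rewrite rmorph_sum. Qed.

Lemma iter_fixed j z : s z = z -> iter j s z = z.
Proof. by move=> sz; elim: j => //= j ->. Qed.

Lemma iter_eigen j c z : s z = emb c * z -> iter j s z = emb c ^+ j * z.
Proof.
move=> sz; elim: j => [|j IH]; first by rewrite expr0 mul1r.
by rewrite /= IH rmorphM rmorphXn /= s_const sz exprSr mulrA.
Qed.

Lemma sum_unity_powers k : ~~ (N %| k)%N -> \sum_(j < N) emb eta ^+ k ^+ j = 0.
Proof.
move=> Nk; have w1 : emb eta ^+ k - 1 != 0.
  rewrite subr_eq0 -rmorphXn -(rmorph1 emb) (inj_eq (fmorph_inj emb)) /=.
  by rewrite -(prim_order_dvd eta_prim).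
apply: (mulfI w1); rewrite -subrX1 mulr0 exprAC -rmorphXn.
by rewrite (prim_expr_order eta_prim) rmorph1 expr1n subrr.
Qed.

(** The discrete Fourier component of z on which s acts by eta ^+ i. *)
Definition isotypic i z : L :=
  N%:R^-1 * \sum_(j < N) (emb eta ^+ i ^+ j)^-1 * iter j s z.

Lemma sum_isotypic z : \sum_(i < N) isotypic i z = z.
Proof.
rewrite -mulr_sumr exchange_big /= (bigD1 (Ordinal N_gt0)) //=.
rewrite [X in _ + X]big1 ?addr0; last first.
  move=> j; rewrite -val_eqE /= => j0; rewrite -mulr_suml.
  have ltjN := ltn_ord j.
  have Nj : ~~ (N %| N - j)%N by apply/negP => /dvdn_leq; lia.
  transitivity ((\sum_(i < N) emb eta ^+ (N - j) ^+ i) * iter j s z); last first.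
    by rewrite sum_unity_powers // mul0r.
  congr (_ * _).
  apply: eq_bigr => i _; rewrite exprAC -exprVn; congr (_ ^+ i).
  apply: (mulIf (expf_neq0 j eta0)); rewrite mulVf ?expf_neq0 //.
  rewrite -exprD subnK; last exact: ltnW.
  by rewrite -rmorphXn /= (prim_expr_order eta_prim) rmorph1.
rewrite (eq_bigr (fun=> z)); last by move=> i _; rewrite expr0 invr1 mul1r.
by rewrite sumr_const card_ord -[z *+ _]mulr_natl mulKf.
Qed.

Lemma isotypic_eigen i z : s (isotypic i z) = emb eta ^+ i * isotypic i z.
Proof.
pose f j := (emb eta ^+ i ^+ j)^-1 * iter j s z.
rewrite /isotypic rmorphM fmorphV rmorph_nat mulrCA; congr (_ * _).
rewrite -[in RHS](@big_ord_cyclic_shift _ _ _ f); last first.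
  rewrite /f s_order expr0 exprAC -rmorphXn (prim_expr_order eta_prim).
  by rewrite rmorph1 expr1n.
rewrite mulr_sumr rmorph_sum; apply: eq_bigr => j _.
rewrite rmorphM fmorphV !rmorphXn /= s_const /f /=.
by rewrite exprS invfM !mulrA divff ?expf_neq0 // mul1r.
Qed.

Lemma isotypic0_fixed z : s z = z -> isotypic 0 z = z.
Proof.
move=> sz; rewrite /isotypic (eq_bigr (fun=> z)); last first.
  by move=> j _; rewrite expr0 expr1n invr1 mul1r iter_fixed.
by rewrite sumr_const card_ord -[z *+ _]mulr_natl mulKf.
Qed.

Lemma isotypic_sum i n (f : 'I_n -> L) :
  isotypic i (\sum_k f k) = \sum_k isotypic i (f k).
Proof.
rewrite /isotypic -mulr_sumr; congr (_ * _); rewrite exchange_big /=.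
by apply: eq_bigr => j _; rewrite iter_rmorph_sum mulr_sumr.
Qed.

Lemma isotypicM i a z : s a = a -> isotypic i (a * z) = a * isotypic i z.
Proof.
move=> sa; rewrite /isotypic mulrCA; congr (_ * _).
rewrite mulr_sumr; apply: eq_bigr => j _.
by rewrite iter_rmorphM iter_fixed // mulrCA.
Qed.

(** A polynomial over the fixed field with root z; it need not be the minimal
    one. *)
Definition orbit_poly z : {poly L} := \prod_(j < N) ('X - (iter j s z)%:P).

Lemma size_orbit_poly z : size (orbit_poly z) = N.+1.
Proof. by rewrite size_prod_XsubC /index_enum -enumT size_enum_ord. Qed.

Lemma root_orbit_poly z : root (orbit_poly z) z.
Proof.
rewrite /orbit_poly -(prednK N_gt0) big_ord_recl /=.
by rewrite rootM root_XsubC eqxx.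
Qed.

Lemma orbit_poly_fixed z i : s (orbit_poly z)`_i = (orbit_poly z)`_i.
Proof.
suff fixed : map_poly s (orbit_poly z) = orbit_poly z by rewrite -coef_map fixed.
rewrite /orbit_poly rmorph_prod /=.
rewrite -[in RHS](@big_ord_cyclic_shift _ _ _ (fun j => 'X - (iter j s z)%:P)).
  by apply: eq_bigr => j _; rewrite rmorphB /= map_polyX map_polyC.
by rewrite s_order.
Qed.

Section FixedField.
Variables (u x y : L).
Hypothesis u_transc : forall p, pev emb u p = 0 -> p = 0.
Hypothesis fractions : forall z, exists g h,
  eval2 emb h x y != 0 /\ z = eval2 emb g x y / eval2 emb h x y.
Hypotheses (sx : s x = x) (sy : s y = emb eta * y).
Hypotheses (x_Fu : in_Fu emb u x) (yN_Fu : in_Fu emb u (y ^+ N)).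

Let poly_xy z := exists g, z = eval2 emb g x y.

(** A monomial x^i y^k is an eigenvector of s, so it contributes to the
    invariant component only if N divides k, that is through a power of
    y^N. *)
Lemma isotypic0_poly_xy g : in_Fu emb u (isotypic 0 (eval2 emb g x y)).
Proof.
rewrite eval2E isotypic_sum; apply: in_Fu_sum => // i _.
rewrite mulrC isotypicM; last by rewrite rmorphXn /= sx.
apply: in_FuM; first exact: in_FuX.
rewrite pevE isotypic_sum; apply: in_Fu_sum => // k _.
rewrite isotypicM //; apply: in_FuM; first exact: in_Fu_const.
have syk : s (y ^+ k) = emb (eta ^+ k) * y ^+ k.
  by rewrite rmorphXn /= sy exprMn rmorphXn.
have [/dvdnP [l kE]|Nk] := boolP (N %| k)%N.
  have yk : y ^+ k = (y ^+ N) ^+ l by rewrite kE mulnC exprM.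
  have syN : s (y ^+ N) = y ^+ N.
    rewrite rmorphXn /= sy exprMn -rmorphXn /= (prim_expr_order eta_prim).
    by rewrite rmorph1 mul1r.
  rewrite yk isotypic0_fixed; first exact: in_FuX.
  by rewrite rmorphXn /= syN.
rewrite /isotypic (_ : \sum_(j < N) _ = 0).
  by rewrite mulr0 -(rmorph0 emb); apply: in_Fu_const.
transitivity ((\sum_(j < N) emb eta ^+ k ^+ j) * y ^+ k); last first.
  by rewrite sum_unity_powers // mul0r.
rewrite mulr_suml.
apply: eq_bigr => j _; rewrite expr0 expr1n invr1 mul1r.
by rewrite (iter_eigen _ syk) rmorphXn.
Qed.

(** Multiplying numerator and denominator of a fraction by the other
    conjugates of the denominator h makes the denominator the norm of h, which
    is invariant; if the fraction is invariant then so is its new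
    numerator. *)
Lemma fixed_in_Fu z : s z = z -> in_Fu emb u z.
Proof.
move=> sz; have [g [h [h0 zE]]] := fractions z.
have poly_xyM a b : poly_xy a -> poly_xy b -> poly_xy (a * b).
  by move=> [k ->] [l ->]; exists (k * l); rewrite eval2M.
have poly_iter j : poly_xy (iter j s (eval2 emb h x y)).
  elim: j => [|j [k IH]]; first by exists h.
  by exists (scaleY eta k); rewrite /= IH eval2_rmorph // sx sy eval2_scaleY.
have fixed_Fu a : poly_xy a -> s a = a -> in_Fu emb u a.
  by move=> [k ->] sk; rewrite -(isotypic0_fixed sk); apply: isotypic0_poly_xy.
pose nrm := \prod_(j < N) iter j s (eval2 emb h x y).
have nrmE :
    nrm = eval2 emb h x y * \prod_(j < N.-1) iter j.+1 s (eval2 emb h x y).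
  rewrite /nrm -(big_mkord xpredT (fun j => iter j s (eval2 emb h x y))).
  by rewrite big_ltn // big_add1 big_mkord.
have poly_prod n (e : nat -> nat) :
    poly_xy (\prod_(j < n) iter (e j) s (eval2 emb h x y)).
  by apply: big_ind => //; exists 1; rewrite eval2_1.
have nrm_fixed : s nrm = nrm.
  rewrite /nrm rmorph_prod /=.
  by rewrite -[in RHS](@big_ord_cyclic_shift _ _ _
                         (fun j => iter j s (eval2 emb h x y))).
have nrm0 : nrm != 0.
  apply/prodf_neq0 => j _; elim: (j : nat) => //= k IH.
  by rewrite fmorph_eq0.
have nrm_Fu : in_Fu emb u nrm by apply: fixed_Fu => //; apply: (poly_prod N id).
have znrm_Fu : in_Fu emb u (z * nrm).
  apply: fixed_Fu; last by rewrite rmorphM /= sz nrm_fixed.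
  rewrite zE nrmE mulrA divfK //; apply: poly_xyM; first by exists g.
  exact: (poly_prod _ S).
by rewrite -(mulfK nrm0 z); apply: in_FuM => //; apply: in_FuV.
Qed.

End FixedField.
End CyclicAction.

(** * Roots of unity and numerical semigroups *)

Lemma finField_has_prim_root (F : finFieldType) n : (n %| #|F|.-1)%N ->
  exists eta : F, n.-primitive_root eta.
Proof.
move=> n_dvd; have F_gt1 := finNzRing_gt1 F.
have F1_gt0 : (0 < #|F|.-1)%N by rewrite -subn1 subn_gt0.
have /hasP [z _ z_prim] : has (#|F|.-1).-primitive_root (enum (predC1 (0 : F))).
  apply: has_prim_root => //; last by rewrite -cardE cardC1.
  - apply/allP => z; rewrite mem_enum !inE => z0; apply/unity_rootP.
    by apply: (mulfI z0); rewrite -exprS prednK ?mulr1 ?expf_card // ltnW.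
  - exact: enum_uniq.
by exists (z ^+ (#|F|.-1 %/ n)); apply: dvdn_prim_root.
Qed.

Lemma generated_semigroup0 s : generated_semigroup s 0%N.
Proof. by exists (fun=> 0%N); rewrite big1. Qed.

Lemma generated_semigroupD s a b : generated_semigroup s a ->
  generated_semigroup s b -> generated_semigroup s (a + b)%N.
Proof.
move=> [c ->] [d ->]; exists (fun i => c i + d i)%N.
by rewrite -big_split; apply: eq_bigr => i _; rewrite mulnDl.
Qed.

Lemma generated_semigroupM s k a : generated_semigroup s a ->
  generated_semigroup s (k * a)%N.
Proof.
move=> Sa; elim: k => [|k IH]; first exact: generated_semigroup0.
by rewrite mulSn; apply: generated_semigroupD.
Qed.

Lemma mem_generated_semigroup s a : a \in s -> generated_semigroup s a.
Proof.
move=> sa; have lt_ia : (index a s < size s)%N by rewrite index_mem.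
exists (fun i => (i == Ordinal lt_ia) : nat).
rewrite (bigD1 (Ordinal lt_ia)) //= eqxx mul1n nth_index //.
by rewrite big1 ?addn0 // => i /negPf ->.
Qed.

(** Write i = k D + r with r < D.  The bounds force j <= k and
    2 k + e <= A, where e, the ceiling of 2 r / D, is 0, 1 or 2.  So n is k
    copies of N - D, some copies of N, and the number e N - r, which is a sum
    of e generators N - r' with r' <= (D - 1) / 2. *)
Lemma pole_number_in_semigroup m D N s n i j A :
    N = (m * D)%N -> (2 < m)%N -> odd D -> (N - D)%N \in s ->
    (forall r, (r <= (D - 1) %/ 2)%N -> (N - r)%N \in s) ->
    (i < N)%N -> (D * j <= i)%N -> (2 * i <= D * A)%N ->
    (n + i + N * j = N * A)%N ->
  generated_semigroup s n.
Proof.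
move=> NE m_gt2 D_odd sND sN lt_iN le_ji le_iA nE.
have D_gt0 : (0 < D)%N by case: D D_odd {NE sND sN le_ji le_iA}.
have DE : (D = 2 * ((D - 1) %/ 2) + 1)%N by lia.
set h := ((D - 1) %/ 2)%N in DE sN.
have le_DN : (D <= N)%N by nia.
pose k := (i %/ D)%N; pose r := (i %% D)%N.
have iE : i = (k * D + r)%N := divn_eq i D.
have lt_rD : (r < D)%N by rewrite ltn_mod.
have le_jk : (j <= k)%N by rewrite leq_divRL // mulnC.
have gN : generated_semigroup s N.
  by have := mem_generated_semigroup (sN 0%N isT); rewrite subn0.
have gND := generated_semigroupM k (mem_generated_semigroup sND).
have [d dE] : exists d, (N = d + D)%N by exists (N - D)%N; rewrite subnK.
have ND : (N - D = d)%N by lia.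
rewrite ND in gND.
(* n = k (N - D) + (A - j - k - e) N + (e N - r) *)
have finish e w : (2 * k + e <= A)%N -> (w + r = e * N)%N ->
    generated_semigroup s w -> generated_semigroup s n.
  move=> le_kA wE gw.
  have -> : n = (k * d + (A - j - k - e) * N + w)%N.
    have [t tE] : exists t, (A = j + k + e + t)%N.
      by exists (A - j - k - e)%N; lia.
    rewrite (_ : A - j - k - e = t)%N; last by lia.
    subst A; rewrite iE in nE; nia.
  apply: generated_semigroupD => //; apply: generated_semigroupD => //.
  exact: generated_semigroupM.
have [r0|r_gt0] := posnP r.
  apply: (finish 0%N 0%N); rewrite ?r0 //; last exact: generated_semigroup0.
  rewrite addn0 -(leq_pmul2l D_gt0); lia.
have [le_rh|lt_hr] := leqP r h.
  apply: (finish 1%N (N - r)%N); last exact/mem_generated_semigroup/sN.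
    by rewrite addn1 -(ltn_pmul2l D_gt0); lia.
  by lia.
apply: (finish 2%N ((N - h) + (N - (r - h)))%N); last first.
- by apply: generated_semigroupD; apply/mem_generated_semigroup/sN => //; lia.
- by lia.
- by rewrite addn2 -(ltn_pmul2l D_gt0); lia.
Qed.

(** * Degrees of the coefficient of an integral component *)

Section LocalBounds.
Variables (F : fieldType) (m D N i : nat) (w : F).
Hypotheses (NE : N = (m * D)%N) (m_neq0 : m%:R != 0 :> F) (w_neq0 : w != 0).
Hypothesis lt_iN : (i < N)%N.

Let W : {poly F} := 1 + w *: 'X.
Let B : {poly F} := W ^+ m + 'X^m.

Let m_gt0 : (0 < m)%N.
Proof. by rewrite lt0n; apply: contraNneq m_neq0 => ->. Qed.

Let coprimep_W_X : coprimep W 'X.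
Proof.
apply/Bezout_eq1_coprimepP; exists (1, - w%:P) => /=.
by rewrite mul1r mulNr mul_polyC addrK.
Qed.

Let coprimep_W_B : coprimep W B.
Proof.
rewrite /B -{1}(prednK m_gt0) exprSr coprimep_addl_mul.
by rewrite coprimep_expr.
Qed.

Let coprimep_X_B : coprimep 'X B.
Proof.
rewrite /B addrC -{1}(prednK m_gt0) exprSr coprimep_addl_mul.
by rewrite coprimep_expr // coprimep_sym.
Qed.

(** B is squarefree: a repeated factor would divide
    m B - X B' = m W ^+ (m - 1), which is prime to B. *)
Let coprimep_factors d c : B = d * c -> coprimep d c.
Proof.
move=> BE; apply/coprimepP => e ed ec.
have euler : B *+ m - 'X * B^`() = W ^+ m.-1 *+ m.
  rewrite /B derivD deriv_exp derivXn /W !derivE add0r.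
  rewrite -{1 2}(prednK m_gt0) !exprS -!mul_polyC.
  move: (m.-1) w%:P 'X => k v t; ring.
have e_dvd_W : e %| W ^+ m.-1.
  have : e %| W ^+ m.-1 *+ m.
    rewrite -euler dvdp_sub //.
      by rewrite -scaler_nat dvdpZr // BE dvdp_mulr.
    rewrite dvdp_mull // BE derivM dvdp_add //; first exact: dvdp_mull.
    exact: dvdp_mulr.
  by rewrite -scaler_nat dvdpZr.
have : coprimep e (W ^+ m.-1).
  apply: coprimep_expr; rewrite coprimep_sym; apply: coprimep_dvdl coprimep_W_B.
  by rewrite BE dvdp_mulr.
by move=> /coprimepP/(_ e (dvdpp e) e_dvd_W).
Qed.

(** Since b is prime to a, b^N divides (W^m B)^i.  As i < N and B is
    squarefree, b has no common factor with B, so b^N divides W^(mi).  On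
    the other side 'X is prime to W and B, so 'X^(2mi) divides a^N. *)
Lemma fraction_bounds (a b p : {poly F}) : coprimep a b -> a != 0 -> b != 0 ->
    a ^+ N * (W ^+ m * B) ^+ i = p * b ^+ N * 'X^(2 * m * i) ->
  (D * (size b).-1 <= i)%N /\ (2 * i <= D * (size a).-1)%N.
Proof.
move=> co_ab a0 b0 abE.
have N_gt0 : (0 < N)%N by case: N lt_iN.
have bN_dvd : b ^+ N %| (W ^+ m * B) ^+ i.
  have : b ^+ N %| a ^+ N * (W ^+ m * B) ^+ i.
    by rewrite abE mulrAC dvdp_mull.
  by rewrite Gauss_dvdpr // coprimep_expl // coprimep_expr // coprimep_sym.
have co_bB : coprimep b B.
  rewrite /coprimep; set d := gcdp b B.
  have db : d %| b := dvdp_gcdl b B.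
  have [c BE] := dvdpP _ _ (dvdp_gcdr b B : d %| B); rewrite mulrC in BE.
  have co_dc := coprimep_factors BE.
  have co_dW : coprimep d W.
    rewrite coprimep_sym; apply: coprimep_dvdl coprimep_W_B.
    by rewrite BE dvdp_mulr.
  have : d ^+ N %| (W ^+ m * B) ^+ i.
    by apply: dvdp_trans bN_dvd; apply: dvdp_exp2r.
  rewrite exprMn Gauss_dvdpr; last first.
    by rewrite coprimep_expl // -exprM coprimep_expr.
  rewrite BE exprMn -(subnK (ltnW lt_iN)) exprD mulrC dvdp_mul2l; last first.
    by rewrite expf_neq0 // gcdp_eq0 negb_and b0.
  move=> dd; have : d ^+ (N - i) %= 1.
    have co : coprimep (d ^+ (N - i)) (c ^+ i).
      by rewrite coprimep_expl // coprimep_expr.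
    by move/coprimepP: co => /(_ _ (dvdpp _) dd).
  rewrite -size_poly_eq1 => /eqP sz1.
  have := size_exp d (N - i); rewrite sz1 => /esym/eqP.
  rewrite muln_eq0 subn_eq0 leqNgt lt_iN orbF => szd.
  have d0 : d != 0 by rewrite gcdp_eq0 negb_and b0.
  by rewrite -(prednK (_ : 0 < size d)%N) ?size_poly_gt0 // (eqP szd).
have szW : size W = 2.
  rewrite /W addrC -mul_polyC size_MXaddC polyC_eq0 (negPf w_neq0).
  by rewrite size_polyC w_neq0.
have W0 : W != 0 by rewrite -size_poly_gt0 szW.
split.
- have bN_dvd_W : b ^+ N %| W ^+ (m * i).
    move: bN_dvd; rewrite exprMn Gauss_dvdpl ?exprM //.
    by rewrite coprimep_expl // coprimep_expr.
  have := dvdp_leq (expf_neq0 _ W0) bN_dvd_W.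
  rewrite -ltnS => szle; rewrite -(leq_pmul2l m_gt0) mulnA -NE mulnC -size_exp.
  move: (size_exp W (m * i)); rewrite szW mul1n => <-.
  by rewrite -!subn1 leq_sub2r.
- have X_dvd : 'X^(2 * m * i) %| a ^+ N.
    have : 'X^(2 * m * i) %| a ^+ N * (W ^+ m * B) ^+ i.
      by rewrite abE dvdp_mull.
    rewrite Gauss_dvdpl //.
    rewrite coprimep_expl // coprimep_expr // coprimepMr coprimep_X_B.
    by rewrite coprimep_expr // coprimep_sym.
  have := dvdp_leq (expf_neq0 _ a0) X_dvd; rewrite size_polyXn => szle.
  rewrite -(leq_pmul2l m_gt0) mulnA [(m * 2)%N]mulnC mulnA -NE.
  rewrite [(N * _)%N]mulnC -size_exp.
  by rewrite -ltnS prednK // size_poly_gt0 expf_neq0.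
Qed.

End LocalBounds.

(** * Pole numbers *)

Section PoleNumbers.
Variables (F L : fieldType) (emb : {rmorphism F -> L}) (P : place emb).

Definition regular_outside f := forall Q : place emb, Q <> P -> 0 <= Q f.

Lemma pole_divisor_regular f n :
  pole_divisor emb f = point_divisor n P -> regular_outside f.
Proof.
move=> fn Q QP; have := congr1 (fun D => D Q) fn.
rewrite /pole_divisor /point_divisor asboolF //.
by move/eqP; rewrite eq_maxl oppr_le0.
Qed.

Lemma pole_divisor_ord f n : (0 < n)%N ->
  pole_divisor emb f = point_divisor n P -> P f = - n%:Z.
Proof.
move=> n_gt0 fn; have := congr1 (fun D => D P) fn.
by rewrite /pole_divisor /point_divisor asboolT //; lia.
Qed.

(** A pole divisor 0 does not force order 0 at P, but the constant 1
    has order 0 everywhere. *)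
Lemma weierstrass_semigroupP n : weierstrass_semigroup P n <->
  exists f, [/\ f != 0, P f = - n%:Z & regular_outside f].
Proof.
split=> [[f f0 fn]|[f [f0 Pf f_reg]]].
  have [->|n_gt0] := posnP n.
    by exists 1; rewrite oner_neq0 ord_at1; split=> // Q _; rewrite ord_at1.
  exists f; split=> //; first exact: pole_divisor_ord.
  exact: pole_divisor_regular fn.
exists f => //; apply/funext => Q; rewrite /pole_divisor /point_divisor.
have [->|QP] := pselect (Q = P); first by rewrite asboolT // Pf; lia.
by rewrite asboolF // max_l // oppr_le0; apply: f_reg.
Qed.

Lemma generated_subset_weierstrass s :
  (forall a, a \in s -> weierstrass_semigroup P a) ->
  (generated_semigroup s `<=` weierstrass_semigroup P)%classic.
Proof.
move=> Hs n [c ->].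
have H0 : weierstrass_semigroup P 0%N.
  apply/weierstrass_semigroupP; exists 1; rewrite oner_neq0 ord_at1.
  split=> // Q _.
  by rewrite ord_at1.
have HD a b : weierstrass_semigroup P a -> weierstrass_semigroup P b ->
    weierstrass_semigroup P (a + b)%N.
  move=> /weierstrass_semigroupP [f [f0 Pf fr]].
  move=> /weierstrass_semigroupP [g [g0 Pg gr]].
  apply/weierstrass_semigroupP; exists (f * g); split; first exact: mulf_neq0.
    by rewrite ord_atM // Pf Pg PoszD opprD.
  by move=> Q QP; apply: ord_atM_ge0; [apply: fr|apply: gr].
apply: (big_ind (weierstrass_semigroup P)) => // i _.
have Hi := Hs _ (mem_nth 0%N (ltn_ord i)).
by elim: (c i) => // k IH; rewrite mulSn; apply: HD.
Qed.
End PoleNumbers.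

(** * The automorphisms of the curve *)

Section CurveAutomorphism.
Variables (F L : fieldType) (emb : {rmorphism F -> L}) (q0 m : nat) (x y : L).
Hypothesis hL : is_function_field_of_plane_curve emb (Xm_poly F q0 m) x y.

Lemma eval2_Xm_poly a b :
  eval2 emb (Xm_poly F q0 m) a b = a ^+ (2 * m) + a ^+ m + b ^+ (q0 + 1).
Proof. by rewrite /Xm_poly !eval2D !eval2Xn eval2X eval2C pevX. Qed.

Lemma curve_equation : y ^+ (q0 + 1) = - (x ^+ (2 * m) + x ^+ m).
Proof.
apply/eqP; rewrite -addr_eq0 addrC -eval2_Xm_poly; apply/eqP/hL.1.
by exists 1; rewrite mul1r.
Qed.

(** (x, eta y) lies on the curve and has no further relations, since
    (x, y) is recovered from it by the inverse scaling. *)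
Lemma curve_automorphism eta : eta ^+ (q0 + 1) = 1 ->
  exists s : {rmorphism L -> L}, [/\ forall c, s (emb c) = emb c, s x = x,
    s y = emb eta * y & forall z, iter (q0 + 1) s z = z].
Proof.
move=> eta1.
have eta0 : emb eta != 0.
  rewrite fmorph_eq0; apply/eqP => e0; move/eqP: eta1.
  by rewrite e0 addn1 expr0n eq_sym oner_eq0.
have on_curve b : b ^+ (q0 + 1) = y ^+ (q0 + 1) ->
    forall g, eval2 emb g x y = 0 -> eval2 emb g x b = 0.
  move=> bE g /hL.1 [h ->]; rewrite eval2M eval2_Xm_poly bE curve_equation.
  by rewrite subrr mulr0.
have same g : eval2 emb g x y = 0 <-> eval2 emb g x (emb eta * y) = 0.
  split; first by apply: on_curve; rewrite exprMn -rmorphXn eta1 rmorph1 mul1r.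
  rewrite -eval2_scaleY => g0; rewrite -[y in LHS](mulVKf eta0) -eval2_scaleY.
  apply: on_curve g0.
  by rewrite exprMn exprVn -rmorphXn eta1 rmorph1 invr1 mul1r.
have [s sE] := function_field_morphism same hL.2.
have s_const c : s (emb c) = emb c by have := sE c%:P%:P; rewrite !eval2C !pevC.
have sx : s x = x by have := sE 'X; rewrite !eval2X.
have sy : s y = emb eta * y by have := sE 'X%:P; rewrite !eval2C !pevX.
exists s; split=> // z.
have iter_poly g : iter (q0 + 1) s (eval2 emb g x y) = eval2 emb g x y.
  have iterE j : iter j s (eval2 emb g x y) = eval2 emb g x (emb eta ^+ j * y).
    elim: j => [|j IH]; first by rewrite expr0 mul1r.
    rewrite /= IH eval2_rmorph // sx rmorphM rmorphXn /= s_const sy.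
    by rewrite exprSr mulrA.
  by rewrite iterE -rmorphXn eta1 rmorph1 mul1r.
have iterV j a : iter j s a^-1 = (iter j s a)^-1.
  by elim: j => //= j ->; rewrite fmorphV.
have [g [h [h0 ->]]] := hL.2 z.
by rewrite iter_rmorphM iterV !iter_poly.
Qed.

(** Composing a place Q other than P with s gives a place again.  It is not P,
    because Q (s u) = Q u is nonnegative; so f has no pole there. *)
Lemma regular_outside_rmorph (s : {rmorphism L -> L}) N (P : place emb) u :
    (forall c, s (emb c) = emb c) -> (0 < N)%N -> (forall z, iter N s z = z) ->
    s u = u -> P u < 0 -> regular_outside P u ->
  forall f, regular_outside P f -> regular_outside P (s f).
Proof.
move=> s_const N_gt0 s_order su Pu u_reg f f_reg Q QP.
have Qs0 : Q (s 0) = 0 by rewrite rmorph0 ord_at0.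
have QsM a b : a != 0 -> b != 0 -> Q (s (a * b)) = Q (s a) + Q (s b).
  by move=> a0 b0; rewrite rmorphM ord_atM // fmorph_eq0.
have QsD a b : a != 0 -> b != 0 -> a + b != 0 ->
    Num.min (Q (s a)) (Q (s b)) <= Q (s (a + b)).
  move=> a0 b0 ab0; rewrite rmorphD.
  by apply: ord_atD; rewrite -?rmorphD fmorph_eq0.
have Qs_const c : Q (s (emb c)) = 0 by rewrite s_const ord_at_const.
have Qs_unif : exists2 t, t != 0 & Q (s t) = 1.
  have [t t0 Qt] := ord_at_uniformizer Q; exists (iter N.-1 s t).
    by elim: N.-1 => //= k; rewrite fmorph_eq0.
  by rewrite -iterS prednK // s_order.
pose Qs := Place Qs0 QsM QsD Qs_const Qs_unif.
apply: (f_reg Qs) => QsP; have : 0 <= Qs u by rewrite /= su; apply: u_reg.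
by rewrite QsP leNgt Pu.
Qed.

End CurveAutomorphism.

(** * The Weierstrass semigroup *)

Section PoleNumbersOfCurve.
Variables (q0 m Delta : nat) (F : finFieldType) (L : fieldType).
Variables (emb : {rmorphism F -> L}) (x y : L) (w : F) (P : place emb).
Local Notation N := (q0 + 1)%N.
Hypotheses (NE : N = (m * Delta)%N) (N_dvd : (N %| #|F|.-1)%N).
Hypothesis w_neq0 : w != 0.
Hypothesis hL : is_function_field_of_plane_curve emb (Xm_poly F q0 m) x y.
Let u := (x - emb w)^-1.
Hypotheses (Pu : P u = - N%:Z) (u_reg : regular_outside P u) (Py : P y = 1).

Let u_pole : P u < 0. Proof. by rewrite Pu oppr_lt0 ltz_nat addn1. Qed.
Let u_neq0 : u != 0.
Proof. by apply: contraTneq u_pole => ->; rewrite ord_at0. Qed.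
Let y_neq0 : y != 0.
Proof. by apply/eqP => y0; move: Py; rewrite y0 ord_at0. Qed.

Let xE : x = emb w + u^-1. Proof. by rewrite /u invrK addrC subrK. Qed.

Let u_transc p : pev emb u p = 0 -> p = 0.
Proof.
move=> /eqP pu0; apply/eqP; apply: contraTT pu0.
by move=> /(ord_pev_pole u_pole) [].
Qed.

Let pev_neq0 p : p != 0 -> pev emb u p != 0.
Proof. by apply: contraNneq => /u_transc ->. Qed.

Let x_Fu : in_Fu emb u x.
Proof.
rewrite xE; apply: in_FuD => //; first exact: in_Fu_const.
by apply: in_FuV => //; have := in_Fu_pev emb u 'X; rewrite pevX.
Qed.

Let yN_Fu : in_Fu emb u (y ^+ N).
Proof.
rewrite (curve_equation hL) -mulN1r -(rmorph1 emb) -rmorphN; apply: in_FuM.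
  exact: in_Fu_const.
by apply: in_FuD => //; apply: in_FuX.
Qed.

Let W : {poly F} := 1 + w *: 'X.
Let B : {poly F} := W ^+ m + 'X^m.

(** The equation of the curve in the coordinate u, where x = W / u. *)
Let yNE : y ^+ N * u ^+ (2 * m) = - pev emb u (W ^+ m * B).
Proof.
have WE : pev emb u W = x * u.
  rewrite /W rmorphD rmorph1 -mul_polyC rmorphM /= pevC pevX xE mulrDl.
  by rewrite mulVf // addrC.
rewrite (curve_equation hL) rmorphM rmorphD !rmorphXn /= pevX WE mulNr.
congr (- _).
rewrite [(2 * m)%N]mulnC !exprM !exprMn; ring.
Qed.

(** The witness i is the index of the component of f that carries its order
    at P; j and A are the degrees of the denominator and of the numerator of
    its coefficient in F (u). *)
Lemma pole_number_bounds n : weierstrass_semigroup P n ->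
  exists i j A, [/\ (i < N)%N, (Delta * j <= i)%N, (2 * i <= Delta * A)%N
    & (n + i + N * j = N * A)%N].
Proof.
move=> /weierstrass_semigroupP [f [f0 Pf f_reg]].
have [eta eta_prim] := finField_has_prim_root N_dvd.
have m_neq0 : m%:R != 0 :> F.
  by apply: (prim_root_dvd_eq0 eta_prim); rewrite NE dvdn_mulr.
have N_gt0 : (0 < N)%N by rewrite addn1.
have [s [s_const sx sy s_order]] :=
  curve_automorphism hL (prim_expr_order eta_prim).
have su : s u = u by rewrite fmorphV rmorphB /= s_const sx.
have Fixed z : s z = z -> in_Fu emb u z.
  exact: (@fixed_in_Fu _ _ emb s N eta eta_prim s_const s_order u x y
            u_transc hL.2).
have Fu_root z : exists p : {poly L},
    [/\ p != 0, forall k, in_Fu emb u p`_k, (size p <= N.+1)%N & root p z].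
  exists (orbit_poly s N z); rewrite -size_poly_gt0 size_orbit_poly.
  split=> //; last exact: (root_orbit_poly s eta_prim).
  by move=> k; apply: Fixed; apply: orbit_poly_fixed.
pose c (i : nat) := isotypic emb s N eta i f.
have c_reg i : regular_outside P (c i).
  move=> Q QP; rewrite /c /isotypic.
  rewrite -(rmorph_nat emb) -fmorphV; apply: ord_atM_ge0.
    by rewrite ord_at_const.
  apply: ord_at_sum_ge0 => j _; apply: ord_atM_ge0.
    by rewrite -!rmorphXn -fmorphV ord_at_const.
  elim: (j : nat) Q QP => [|k IH] Q QP; first exact: f_reg.
  exact: (regular_outside_rmorph s_const N_gt0 s_order su u_pole u_reg).
have c_shape i : c i != 0 -> exists a b,
    [/\ coprimep a b, a != 0, b != 0 & c i = pev emb u a / pev emb u b * y ^+ i].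
  move=> ci0; have [|a [b [co_ab b0 gE]]] :=
    @in_Fu_reduced _ _ emb u u_transc (c i / y ^+ i).
    apply: Fixed; rewrite rmorphM fmorphV rmorphXn /= sy.
    rewrite (isotypic_eigen eta_prim s_const s_order) -/(c i).
    have eta0 : emb eta ^+ i != 0.
      rewrite expf_neq0 // fmorph_eq0; apply/eqP => e0.
      have /eqP := prim_expr_order eta_prim.
      by rewrite e0 addn1 expr0n eq_sym oner_eq0.
    by rewrite exprMn -mulf_div divff ?mul1r.
  exists a, b; split=> //; last by rewrite -gE divfK ?expf_neq0.
  apply: contraNneq ci0 => a0.
  by rewrite -(divfK (expf_neq0 i y_neq0) (c i)) gE a0 rmorph0 !mul0r.
have ord_c i a b : a != 0 -> b != 0 -> c i = pev emb u a / pev emb u b * y ^+ i ->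
    P (c i) = i%:Z + N%:Z * ((size b).-1%:Z - (size a).-1%:Z).
  move=> a0 b0 ->; have [au0 Pa] := ord_pev_pole u_pole a0.
  have [bu0 Pb] := ord_pev_pole u_pole b0.
  rewrite !ord_atM ?mulf_neq0 ?invr_eq0 ?expf_neq0 // ord_atV ord_atX //.
  rewrite Pa Pb Py Pu.
  move: (size a).-1 (size b).-1 => k l.
  rewrite -[_ *+ k]mulr_natr -[_ *+ l]mulr_natr !natz; ring.
(* the nonzero components have distinct orders, because the order of the i-th
   one is i modulo N *)
have [i [ci0 PfE]] : exists i : 'I_N, c i != 0 /\ P f = P (c i).
  have fE : \sum_(i < N) c i = f by rewrite /c (sum_isotypic emb s eta_prim).
  have [|i j _ _||i [_ ci0 PfE]] :=
    @ord_at_sum_distinct _ _ _ P _ (index_enum 'I_N) (fun i : 'I_N => c i).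
  - exact: index_enum_uniq.
  - move=> ci0 cj0 Pij.
    have [a [b [_ a0 b0 ciE]]] := c_shape _ ci0.
    have [a' [b' [_ a'0 b'0 cjE]]] := c_shape _ cj0.
    move: Pij; rewrite (ord_c i a b) // (ord_c j a' b') // => Pij.
    apply: val_inj; have := congr1 (fun k => (k %% N%:Z)%Z) Pij.
    rewrite ![_ + N%:Z * _]addrC ![N%:Z * _]mulrC !modzMDl !modz_small.
    + by case.
    + by rewrite /= ltz_nat ltn_ord.
    + by rewrite /= ltz_nat ltn_ord.
  - by rewrite fE.
  - by exists i; rewrite -PfE fE.
have [a [b [co_ab a0 b0 ciE]]] := c_shape _ ci0.
have [p pE] : exists p, c i ^+ N = pev emb u p.
  apply: (regular_in_Fu_polynomial u_transc Fu_root u_pole).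
    rewrite ciE exprMn -exprM mulnC exprM; apply: in_FuM; last exact: in_FuX.
    by apply: in_FuX; exists a, b.
  move=> Q QP; rewrite ord_atX // mulrn_wge0 //; exact: c_reg.
have bu0 := pev_neq0 b0.
(* the equation c i ^+ N = p (u), cleared of denominators by means of yNE *)
have abE : a ^+ N * (W ^+ m * B) ^+ i = (-1) ^+ i * p * b ^+ N * 'X^(2 * m * i).
  apply/eqP; rewrite -subr_eq0; apply/eqP/u_transc.
  apply/eqP; rewrite rmorphB subr_eq0; apply/eqP.
  have zE : c i ^+ N * pev emb u b ^+ N = pev emb u a ^+ N * (y ^+ N) ^+ i.
    by rewrite ciE -exprMn mulrAC divfK // exprMn -!exprM mulnC.
  rewrite 4!rmorphM !(rmorphXn (pev emb u)) rmorphN1 /= -pE pevX.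
  rewrite -[_ * _ * pev emb u b ^+ N]mulrA zE exprM -!mulrA -exprMn yNE.
  by rewrite (exprNn (pev emb u _)) [RHS]mulrCA signrMK.
have [le_bi le_ia] :=
  fraction_bounds NE m_neq0 w_neq0 (ltn_ord i) co_ab a0 b0 abE.
exists i, (size b).-1, (size a).-1; split=> //.
have := ord_c _ _ _ a0 b0 ciE; rewrite -PfE Pf => nE.
apply/eqP; rewrite -eqz_nat; apply/eqP; move: nE.
move: (size a).-1 (size b).-1 => k l; nia.
Qed.
End PoleNumbersOfCurve.

Theorem theorem3p2 (q0 q m Delta : nat) (F : finFieldType) (L : fieldType)
  (emb : {rmorphism F -> L}) (x y : L) (omega : F) (P : place emb)
  (hq0 : exists p k : nat, prime p /\ (0 < k)%N /\ q0 = (p ^ k)%N)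
  (hq : q = (q0 ^ 2)%N)
  (hF : #|F| = q)
  (hm : (2 < m)%N)
  (hmd : (m %| q0 + 1)%N)
  (hDelta : Delta = ((q0 + 1) %/ m)%N)
  (hDelta3 : (3 < Delta)%N)
  (hDelta_prime : prime Delta)
  (hL : is_function_field_of_plane_curve emb (Xm_poly F q0 m) x y)
  (homega : primitive_root_of m (-1) omega)
  (hP : rational_place P)
  (hP1 : pole_divisor emb (1 / (x - emb omega)) = point_divisor (q0 + 1) P)
  (hP2 : pole_divisor emb ((x^-1 * y ^+ Delta) / (x - emb omega))
         = point_divisor (q0 + 1 - Delta) P)
  (hP3 : forall n : nat, (1 <= n <= (Delta - 1) %/ 2)%N ->
         pole_divisor emb (y ^+ n / (x - emb omega))
         = point_divisor (q0 + 1 - n) P) :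
  weierstrass_semigroup P
  = generated_semigroup
      ((q0 + 1 - Delta)%N
         :: index_iota (q0 + 1 - (Delta - 1) %/ 2) (q0 + 1).+1).
Proof.
set N := (q0 + 1)%N in hmd hDelta hP1 hP2 hP3 *.
set h := ((Delta - 1) %/ 2)%N in hP3 *.
set gens := (_ :: _).
have NE : N = (m * Delta)%N by rewrite hDelta mulnC divnK.
have Delta_odd : odd Delta.
  by case: (even_prime hDelta_prime) => // D2; rewrite D2 in hDelta3.
have h_gt0 : (0 < h)%N by rewrite divn_gt0 //; lia.
have le_hN : (h < N)%N by have := leq_div (Delta - 1) 2; rewrite -/h; nia.
have lt_DN : (Delta < N)%N by nia.
have N_dvd : (N %| #|F|.-1)%N.
  apply/dvdnP; exists (q0 - 1)%N; rewrite hF hq /N; nia.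
have w0 : omega != 0.
  case: homega => + _; apply: contra_eqN => /eqP->.
  by rewrite expr0n gtn_eqF ?(ltn_trans _ hm) // eq_sym oppr_eq0 oner_eq0.
have pole_semigroup f n : (0 < n)%N -> pole_divisor emb f = point_divisor n P ->
    weierstrass_semigroup P n.
  move=> n_gt0 fn; exists f => //; apply/eqP => f0.
  by have := pole_divisor_ord n_gt0 fn; rewrite f0 ord_at0; lia.
have gensP r : (r <= h)%N -> (N - r)%N \in gens.
  by move=> le_rh; rewrite inE mem_index_iota; apply/orP; right; lia.
rewrite eqEsubset; split; last first.
  apply: generated_subset_weierstrass => a; rewrite inE => /orP[/eqP->|].
    by apply: pole_semigroup hP2; rewrite subn_gt0.
  rewrite mem_index_iota => /andP[le_ha le_aN].
  have [a_eq|lt_aN] := eqVneq a N.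
    by rewrite a_eq; apply: pole_semigroup hP1; rewrite /N addn1.
  have aE : a = (N - (N - a))%N by lia.
  rewrite aE; apply: pole_semigroup (hP3 _ _); lia.
rewrite div1r in hP1.
have Pu : P (x - emb omega)^-1 = - N%:Z.
  by apply: pole_divisor_ord hP1; rewrite /N addn1.
have u_reg := pole_divisor_regular hP1.
have Py : P y = 1.
  have /pole_divisor_ord :
      pole_divisor emb (y ^+ 1 / (x - emb omega)) = point_divisor (N - 1) P.
    by apply: hP3; rewrite h_gt0.
  have N1_gt0 : (0 < N - 1)%N by lia.
  move=> /(_ N1_gt0); rewrite expr1 => Pyu.
  have yu0 : y / (x - emb omega) != 0.
    by apply/eqP => e; move: Pyu; rewrite e ord_at0; lia.
  move: yu0; rewrite mulf_eq0 negb_or => /andP[y0 u0].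
  by move: Pyu; rewrite ord_atM // Pu; lia.
move=> n /(pole_number_bounds NE N_dvd w0 hL Pu u_reg Py).
move=> [i [j [A [lt_iN le_ji le_iA nE]]]].
apply: (pole_number_in_semigroup NE hm Delta_odd _ gensP lt_iN le_ji le_iA nE).
exact: mem_head.
Qed.
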